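(* For every real number $H$ different from $0$, $\frac{1}{\sqrt{3}}$ and $-\frac{1}{\sqrt{3}}$ there exists a non-isoparametric embedded compact surface in $S^3$ with constant mean curvature $H$.
   Context: $S^{3}$ is the unit sphere in $\mathbb{R}^{4}$. The mean curvature of a surface with principal curvatures $\kappa_1,\kappa_2$ (with respect to a choice of unit normal field) is $H=\frac{\kappa_1+\kappa_2}{2}$. A surface is isoparametric if its principal curvatures are constant. *)

(* Defs.v *)
From HB Require Import structures.
From mathcomp Require Import all_boot all_order all_algebra.
From mathcomp Require Import all_classical all_reals all_analysis.

Set Implicit Arguments.
Unset Strict Implicit.
Unset Printing Implicit Defensive.

Import Order.TTheory GRing.Theory Num.Theory.
Import numFieldNormedType.Exports.

Local Open Scope classical_set_scope.
Local Open Scope ring_scope.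

(* The norm that the library puts on row vectors is the sup norm; it induces
   the usual topology and differentiability, but lengths and angles have to be
   expressed through this inner product. *)
Definition dotv (R : realType) (n : nat) (u v : 'rV[R]_n) : R :=
  \sum_(i < n) u 0 i * v 0 i.

Definition sphere3 (R : realType) : set 'rV[R]_4 := [set x | dotv x x = 1].

Fixpoint Ck_on (R : realType) (V W : normedModType R) (k : nat)
    (U : set V) (f : V -> W) : Prop :=
  match k with
  | 0 => forall x, U x -> {for x, continuous f}
  | k'.+1 => (forall x, U x -> differentiable f x) /\
             (forall v : V, Ck_on k' U (fun x => 'D_v f x))
  end.

Definition smooth_on (R : realType) (V W : normedModType R)
    (U : set V) (f : V -> W) : Prop :=
  forall k, Ck_on k U f.

(* [phi], restricted to the open set [U] of the plane, is a smooth immersion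
   and a homeomorphism onto the part of [M] lying in the open set [O]. *)
Definition local_parametrization (R : realType) (M : set 'rV[R]_4)
    (U : set 'rV[R]_2) (O : set 'rV[R]_4) (phi : 'rV[R]_2 -> 'rV[R]_4) : Prop :=
  [/\ open U /\ open O,
      smooth_on U phi,
      forall u, U u -> injective ('d phi u),
      phi @` U = M `&` O
    & exists psi : 'rV[R]_4 -> 'rV[R]_2,
        {within M `&` O, continuous psi} /\
        (forall u, U u -> psi (phi u) = u)].

(* Embedded surfaces are identified with their images; they are connected and
   without boundary. *)
Definition embedded_compact_surface (R : realType) (M : set 'rV[R]_4) : Prop :=
  [/\ M !=set0, compact M, connected M, M `<=` @sphere3 R
    & forall p, M p -> exists U O phi, local_parametrization M U O phi /\ O p].

Definition curve_through (R : realType) (M : set 'rV[R]_4)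
    (p w : 'rV[R]_4) (c : R -> 'rV[R]_4) : Prop :=
  [/\ c 0 = p, (\forall t \near (0 : R), M (c t))
    & is_derive (0 : R) (1 : R) c w].

Definition tangent_space (R : realType) (M : set 'rV[R]_4) (p : 'rV[R]_4) :
    set 'rV[R]_4 :=
  [set w | exists c, curve_through M p w c].

(* [N] is tangent to the sphere and normal to [M]; only its values on [M]
   matter. *)
Definition unit_normal_field (R : realType) (M : set 'rV[R]_4)
    (N : 'rV[R]_4 -> 'rV[R]_4) : Prop :=
  (forall p, M p ->
     [/\ dotv (N p) (N p) = 1, dotv (N p) p = 0
       & forall w, tangent_space M p w -> dotv (N p) w = 0]) /\
  (forall p, M p -> exists U O phi,
     [/\ local_parametrization M U O phi, O p & smooth_on U (N \o phi)]).

(* The graph of the shape operator w |-> - dN_p(w) of [M] in the sphere, where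
   dN_p(c'(0)) = (N o c)'(0) for a curve [c] in [M] (this depends only on
   c'(0)).  For w tangent to [M], <D_w N, p> = - <N p, w> = 0, so the derivative
   of [N] in R^4 is already its covariant derivative in the sphere. *)
Definition shape_operator (R : realType) (M : set 'rV[R]_4)
    (N : 'rV[R]_4 -> 'rV[R]_4) (p w z : 'rV[R]_4) : Prop :=
  exists c, curve_through M p w c /\
            is_derive (0 : R) (1 : R) (N \o c) (- z).

(* [k1] and [k2] are the eigenvalues, with multiplicity, of the (self-adjoint)
   shape operator at [p]; [e1] and [e2] are principal directions. *)
Definition principal_curvatures (R : realType) (M : set 'rV[R]_4)
    (N : 'rV[R]_4 -> 'rV[R]_4) (p : 'rV[R]_4) (k1 k2 : R) : Prop :=
  exists e1 e2 : 'rV[R]_4,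
    [/\ dotv e1 e1 = 1, dotv e2 e2 = 1, dotv e1 e2 = 0,
        shape_operator M N p e1 (k1 *: e1)
      & shape_operator M N p e2 (k2 *: e2)].

Definition mean_curvature (R : realType) (M : set 'rV[R]_4)
    (N : 'rV[R]_4 -> 'rV[R]_4) (p : 'rV[R]_4) (H : R) : Prop :=
  exists k1 k2, principal_curvatures M N p k1 k2 /\ H = (k1 + k2) / 2.

Definition has_constant_mean_curvature (R : realType) (M : set 'rV[R]_4)
    (H : R) : Prop :=
  exists N, unit_normal_field M N /\ forall p, M p -> mean_curvature M N p H.

Definition isoparametric (R : realType) (M : set 'rV[R]_4) : Prop :=
  exists N, unit_normal_field M N /\
  exists k1 k2, forall p, M p -> principal_curvatures M N p k1 k2.

(* Main.v *)
(* Write |H| = cot phi with 0 < phi < pi / 2. For a surface of revolution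
   (r e^{iv}, rho e^{i theta}) of S^3, constancy of the mean curvature is
   equivalent to the conservation of a flux, and in a suitable parameter t this
   makes r^2 explicit: r = sin (c / 2), where c is the side opposite to the
   angle pi - t in a spherical triangle whose other two sides are phi and a
   free parameter e in ]0, phi[. Along such a profile theta is increasing, so
   the surface closes up to an embedded torus as soon as the increment Theta(e)
   of theta over one period of t is 2 pi / m for some integer m > 0. The
   function Theta is continuous on [0, phi], with Theta(0) = 2 pi sin (phi / 2)
   (the tori converge to a Clifford torus) and Theta(phi) = 2 phi (they
   degenerate to a chain of spheres). Some 2 pi / m lies strictly between these
   values unless phi = pi / 3, that is |H| = 1 / sqrt 3; the intermediate value
   theorem concludes. The torus is not isoparametric because r is not constant
   along its profile. *)
Require Import Defs.
From mathcomp Require Import all_boot all_order all_algebra.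
From mathcomp Require Import all_classical all_reals all_analysis.
From mathcomp Require Import measurable_realfun ring lra.

Set Implicit Arguments.
Unset Strict Implicit.
Unset Printing Implicit Defensive.

Import Order.TTheory GRing.Theory Num.Theory.
Import numFieldNormedType.Exports.

Local Open Scope classical_set_scope.
Local Open Scope ring_scope.

(** * Smooth maps with values in row vectors *)

(** Inverting t -> theta(t) gives no formula to differentiate repeatedly. But with theta as
    variable, the functions in play and their inverses satisfy a first-order system polynomial in
    themselves, so all derivatives stay in one ring and smoothness of every order follows from first
    derivatives. The delicate point of the period function is e = phi: the integrand has r in the
    denominator, and r vanishes at t = pi and t = - pi. An algebraic identity bounds the integrand
    uniformly up to that value, so dominated convergence applies. At phi = pi / 3 the two limits are
    2 pi / 3 and pi, consecutive members of the sequence 2 pi / m, with none strictly between; this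
    is where the excluded values come from. An isoparametric structure may come with another normal
    field and list the two curvatures in either order, so a nonconstant r must be turned into an
    obstruction that survives these choices. The quantity (kappa - H)^2 does: constant curvatures
    k1, k2 allow it at most the two values (k1 - H)^2 and (k1 + H)^2, whereas it takes three along
    the profile. *)

Inductive generated_ring (R : realType) (T : Type) (G : set (T -> R)) :
    (T -> R) -> Prop :=
| generated_in f : G f -> generated_ring G f
| generated_cst c : generated_ring G (fun=> c)
| generated_add f g : generated_ring G f -> generated_ring G g ->
    generated_ring G (fun x => f x + g x)
| generated_mul f g : generated_ring G f -> generated_ring G g ->
    generated_ring G (fun x => f x * g x).

Lemma generated_opp (R : realType) (T : Type) (G : set (T -> R)) f :
  generated_ring G f -> generated_ring G (fun x => - f x).
Proof.
move=> Gf; rewrite (_ : (fun x => - f x) = (fun x => -1 * f x)).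
  by apply: generated_mul => //; exact: generated_cst.
by apply/funext => x; rewrite mulN1r.
Qed.

Lemma generated_eq (R : realType) (T : Type) (G : set (T -> R)) f g :
  (forall x, f x = g x) -> generated_ring G g -> generated_ring G f.
Proof. by move=> /funext ->. Qed.

Lemma generated_comp (R : realType) (T U : Type) (G : set (T -> R))
    (G' : set (U -> R)) (h : U -> T) :
  (forall g, G g -> generated_ring G' (g \o h)) ->
  forall f, generated_ring G f -> generated_ring G' (f \o h).
Proof.
move=> GG' f; elim=> [g /GG' //|c|g1 g2 _ h1 _ h2|g1 g2 _ h1 _ h2].
- exact: generated_cst.
- exact: generated_add.
- exact: generated_mul.
Qed.

Section smooth_generated_ring.
Context {R : realType} {V : normedModType R}.
Context (G : set (V -> R)).
Context (differentiable_G : forall g x, G g -> differentiable g x).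
Context (derive_G :
  forall g v, G g -> generated_ring G (fun x => 'D_v g x)).

Lemma differentiable_generated f x :
  generated_ring G f -> differentiable f x.
Proof.
elim=> [g Gg|c|g1 g2 _ h1 _ h2|g1 g2 _ h1 _ h2].
- exact: differentiable_G.
- exact: differentiable_cst.
- exact: differentiableD.
- exact: differentiableM.
Qed.

Lemma derive_generated f v :
  generated_ring G f -> generated_ring G (fun x => 'D_v f x).
Proof.
elim=> [g Gg|c|g1 g2 G1 h1 G2 h2|g1 g2 G1 h1 G2 h2].
- exact: derive_G.
- have -> : (fun x => 'D_v (fun=> c) x) = (fun=> 0) :> (V -> R).
    by apply/funext => x; exact: derive_cst.
  exact: generated_cst.
- have -> : (fun x => 'D_v (fun y => g1 y + g2 y) x) =
            (fun x => 'D_v g1 x + 'D_v g2 x).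
    apply/funext => x; rewrite -deriveD //;
      exact/diff_derivable/differentiable_generated.
  exact: generated_add.
- have -> : (fun x => 'D_v (fun y => g1 y * g2 y) x) =
            (fun x => g1 x * 'D_v g2 x + g2 x * 'D_v g1 x).
    apply/funext => x; rewrite -[RHS]deriveM //;
      exact/diff_derivable/differentiable_generated.
  by apply: generated_add; exact: generated_mul.
Qed.

Lemma differentiable_coordinatewise n (f : V -> 'rV[R]_n) x :
  (forall i, differentiable (fun y => f y 0 i) x) -> differentiable f x.
Proof.
move=> df.
have -> : f = \sum_(i < n) (fun y => f y 0 i *: delta_mx 0 i).
  apply/funext => y; rewrite fct_sumE; exact: row_sum_delta.
by apply: differentiable_sum => i; exact: differentiableZl.
Qed.

(** A directional derivative of a ring element is again in the ring, so the induction on the order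
    applies to the derivative itself, coordinate by coordinate. *)
Lemma smooth_generated n (f : V -> 'rV[R]_n) U :
  (forall i, generated_ring G (fun y => f y 0 i)) -> smooth_on U f.
Proof.
move=> Gf k; elim: k f Gf => [|k IH] f Gf.
  move=> x _; apply: differentiable_continuous.
  by apply: differentiable_coordinatewise => i; exact: differentiable_generated.
have df x : differentiable f x.
  by apply: differentiable_coordinatewise => i; exact: differentiable_generated.
split=> // v; apply: IH => i.
have -> : (fun y => ('D_v f y : 'rV[R]_n) 0 i) =
          (fun y => 'D_v (fun z => f z 0 i) y).
  by apply/funext => y; rewrite derive_mx ?mxE //; exact: diff_derivable.
exact: derive_generated.
Qed.

End smooth_generated_ring.

(** Only the generators need derivatives in the ring; the Leibniz rule extends this to all its
    elements. *)
Definition derivative_closed (R : realType) (G : set (R -> R)) :=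
  forall g, G g -> exists2 g', generated_ring G g' &
    forall x, is_derive x (1 : R) g (g' x).

Definition coordinate_functions (R : realType) (G : set (R -> R)) :
    set ('rV[R]_2 -> R) :=
  [set f | exists2 g, G g & exists i : 'I_2, f = (fun x : 'rV[R]_2 => g (x 0 i))].

Lemma differentiable_comp_coord (R : realType) n (g : R -> R)
    (x : 'rV[R]_n) (i : 'I_n) :
  derivable g (x 0 i) 1 -> differentiable (fun y : 'rV[R]_n => g (y 0 i)) x.
Proof.
move=> dg; apply: (@differentiable_comp _ _ _ _ (fun y : 'rV[R]_n => y 0 i) g).
  exact: differentiable_coord.
exact/derivable1_diffP.
Qed.

Lemma is_derive_comp_coord (R : realType) n (g : R -> R) (dg : R)
    (x v : 'rV[R]_n) (i : 'I_n) :
  is_derive (x 0 i) (1 : R) g dg ->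
  is_derive x v (fun y => g (y 0 i)) (v 0 i * dg).
Proof.
move=> [drg <-]; have dcg := differentiable_comp_coord drg.
apply: DeriveDef; first exact: diff_derivable.
rewrite deriveE //.
have dc : differentiable (fun y : 'rV[R]_n => y 0 i) x.
  exact: differentiable_coord.
rewrite (@diff_comp _ _ _ _ (fun y : 'rV[R]_n => y 0 i) g) //=; last first.
  exact/derivable1_diffP.
rewrite deriv1E // derive1E -deriveE //; congr (_ * _).
have /= := @derive_mx _ _ _ _ (fun y : 'rV[R]_n => y) x v (@derivable_id _ _ _ _).
by move=> /(congr1 (fun M : 'rV_n => M 0 i)); rewrite derive_id mxE.
Qed.

Lemma smooth_coordinate_functions (R : realType) (G : set (R -> R)) n
    (f : 'rV[R]_2 -> 'rV[R]_n) U :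
  derivative_closed G ->
  (forall i, generated_ring (coordinate_functions G) (fun y => f y 0 i)) ->
  smooth_on U f.
Proof.
move=> dG; apply: smooth_generated => [_ x [g /dG [g' _ dg] [i ->]]|].
  by apply: differentiable_comp_coord.
move=> _ v [g /dG [g' Gg' dg] [i ->]].
rewrite (_ : (fun x => 'D_v _ x) = fun x : 'rV[R]_2 => v 0 i * g' (x 0 i)).
  apply: generated_mul; first exact: generated_cst.
  apply: (@generated_comp _ _ _ G _ (fun x : 'rV[R]_2 => x 0 i)) => // h Gh.
  by apply: generated_in; exists h => //; exists i.
by apply/funext => x; apply: derive_val; exact: is_derive_comp_coord.
Qed.

(** * Angles *)

Section angles.
Context {R : realType}.
Implicit Types x y a b s : R.

Lemma periodic_int (f : R -> R) (T : R) (k : int) x :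
  (forall y, f (y + T) = f y) -> f (x + T *~ k) = f x.
Proof.
move=> fT; case: k => n.
  by rewrite -pmulrn; apply: periodicn.
by rewrite NegzE mulrNz -pmulrn -[LHS](periodicn fT n.+1) subrK.
Qed.

Lemma angle_reduction a : exists k : int, - pi <= a + (pi *+ 2) *~ k < pi.
Proof.
have p0 : 0 < pi *+ 2 :> R by rewrite pmulrn_lgt0 // pi_gt0.
pose q := (a + pi) / (pi *+ 2); exists (- Num.floor q).
have /andP[ql qr] := floor_itv q.
have e : a = q * (pi *+ 2) - pi by rewrite /q divfK ?gt_eqF // addrK.
rewrite mulrNz -mulrzl [X in X - _]e.
rewrite -subr_ge0 opprK -[X in _ && X]subr_gt0; move: qr.
rewrite intrD -/(_%:~R) => qr.
have h1 : 0 <= (q - (Num.floor q)%:~R) * (pi *+ 2).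
  by rewrite mulr_ge0 ?subr_ge0 // ltW.
have h2 : 0 < (1 + (Num.floor q)%:~R - q) * (pi *+ 2).
  by rewrite mulr_gt0 // subr_gt0 addrC.
apply/andP; split.
  by apply: le_trans h1 _; rewrite le_eqVlt; apply/orP; left; apply/eqP; ring.
by apply: lt_le_trans h2 _; rewrite le_eqVlt; apply/orP; left; apply/eqP; ring.
Qed.

Lemma cos_eq1 a : cos a = 1 -> - pi <= a < pi -> a = 0.
Proof.
move=> c1 /andP[al ar].
have : `|a| = 0.
  apply: cos_inj; rewrite ?in_itv /= ?lexx ?pi_ge0 ?normr_ge0 //=.
    by rewrite ler_norml al ltW.
  by rewrite cos_norm c1 cos0.
by move/normr0P/eqP.
Qed.

Lemma angle_eq_mod a b : cos a = cos b -> sin a = sin b ->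
  exists k : int, a = b + (pi *+ 2) *~ k.
Proof.
move=> cab sab; have [k kab] := angle_reduction (a - b).
exists (- k); apply/eqP; rewrite mulrNz -subr_eq0; apply/eqP.
rewrite -[RHS](@cos_eq1 (a - b + (pi *+ 2) *~ k)) //; first by ring.
rewrite periodic_int; last exact: cosD2pi.
by rewrite cosB cab sab -!expr2 cos2Dsin2.
Qed.

(* The argument of x + iy in ]-pi, pi[, by the half-angle formula. *)
Definition angle x y : R := 2 * atan (y / (Num.sqrt (x ^+ 2 + y ^+ 2) + x)).

Lemma sqrt_polar s a : 0 <= s ->
  Num.sqrt ((s * cos a) ^+ 2 + (s * sin a) ^+ 2) = s.
Proof.
by move=> s0; rewrite !exprMn -mulrDr cos2Dsin2 mulr1 sqrtr_sqr ger0_norm.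
Qed.

Lemma onePcos_gt0 a : - pi < a < pi -> 0 < 1 + cos a.
Proof.
move=> /andP[al ar].
have -> : a = (a / 2) *+ 2 by rewrite -mulr_natr divfK.
rewrite cos_mulr2n.
have h : 0 < cos (a / 2) ^+ 2.
  apply: exprn_gt0; apply: cos_gt0_pihalf.
  by rewrite -mulNr !ltr_pM2r // al.
by rewrite addrCA subrr addr0 pmulrn_lgt0.
Qed.

Lemma angle_polar s a : 0 < s -> - pi < a < pi ->
  angle (s * cos a) (s * sin a) = a.
Proof.
move=> s0 a1; rewrite /angle sqrt_polar ?ltW // -{2}[s]mulr1 -mulrDr.
rewrite -mulf_div divff ?gt_eqF // mul1r.
have /andP[al ar] := a1.
have ha : - (pi / 2) < a / 2 < pi / 2 by rewrite -mulNr !ltr_pM2r // al.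
have c0 := cos_gt0_pihalf ha.
have {1 2}-> : a = (a / 2) *+ 2 by rewrite -mulr_natr divfK.
rewrite sin_mulr2n cos_mulr2n addrCA subrr addr0.
rewrite (_ : _ / _ = tan (a / 2)) ?tanK ?in_itv //; first by rewrite mulrC divfK.
by rewrite /tan; field; rewrite gt_eqF.
Qed.

Lemma differentiable_sqr (V : normedModType R) (f : V -> R) p :
  differentiable f p -> differentiable (fun q => f q ^+ 2) p.
Proof. by move=> df; under eq_fun do rewrite expr2; exact: differentiableM. Qed.

Lemma differentiable_angle (V : normedModType R) (f g : V -> R) p :
  differentiable f p -> differentiable g p ->
  0 < Num.sqrt (f p ^+ 2 + g p ^+ 2) + f p ->
  differentiable (fun q => angle (f q) (g q)) p.
Proof.
move=> df dg pos.
(* The square root is differentiable only away from 0; positivity of the denominator rules out the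
   origin. *)
have sq0 : 0 < f p ^+ 2 + g p ^+ 2.
  rewrite lt_neqAle addr_ge0 ?sqr_ge0 // andbT eq_sym.
  apply: contraTneq pos => z; rewrite z sqrtr0 add0r -leNgt.
  have /eqP := z; rewrite paddr_eq0 ?sqr_ge0 // sqrf_eq0 => /andP[/eqP-> _].
  exact: lexx.
have dsum : differentiable (fun q => f q ^+ 2 + g q ^+ 2) p.
  by apply: differentiableD; exact: differentiable_sqr.
have ds : differentiable (fun q => Num.sqrt (f q ^+ 2 + g q ^+ 2)) p.
  apply: (@differentiable_comp _ _ _ _ (fun q => f q ^+ 2 + g q ^+ 2)) => //.
  by apply/derivable1_diffP; have [] := is_derive1_sqrt sq0.
have dden : differentiable (fun q => Num.sqrt (f q ^+ 2 + g q ^+ 2) + f q) p.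
  exact: differentiableD.
have dq : differentiable
    (fun q => g q / (Num.sqrt (f q ^+ 2 + g q ^+ 2) + f q)) p.
  by apply: differentiableM => //; apply: differentiableV => //; rewrite gt_eqF.
rewrite /angle; apply: differentiableM; first exact: differentiable_cst.
apply: (@differentiable_comp _ _ _ _
  (fun q => g q / (Num.sqrt (f q ^+ 2 + g q ^+ 2) + f q)) (@atan R)) => //.
exact/derivable1_diffP/derivable_atan.
Qed.

End angles.

(** * Frames of R^4 adapted to surfaces of revolution *)

Section frames.
Context {R : realType}.

Definition pair_row (a b : R) : 'rV[R]_2 := \row_i nth 0 [:: a; b] i.

Definition quad_row (a b c d : R) : 'rV[R]_4 := \row_i nth 0 [:: a; b; c; d] i.

Lemma pair_row_eta (x : 'rV[R]_2) : x = pair_row (x 0 0) (x 0 1).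
Proof.
apply/rowP => -[[|[|//]] i]; rewrite mxE /=; congr (x _ _); exact: val_inj.
Qed.

Lemma quad_row_eta (x : 'rV[R]_4) :
  x = quad_row (x 0 0) (x 0 1) (x 0 2%:R) (x 0 3%:R).
Proof.
apply/rowP => -[[|[|[|[|//]]]] i]; rewrite mxE /=; congr (x _ _);
  exact: val_inj.
Qed.

Lemma dotv_quad_row (a b c d a' b' c' d' : R) :
  dotv (quad_row a b c d) (quad_row a' b' c' d') =
  a * a' + b * b' + c * c' + d * d'.
Proof. by rewrite /dotv !big_ord_recl big_ord0 !mxE /= addr0 !addrA. Qed.

Lemma is_derive_coordinatewise (V : normedModType R) n (f : V -> 'rV[R]_n)
    (x v : V) (df : 'rV[R]_n) :
  (forall i, is_derive x v (fun y => f y 0 i) (df 0 i)) -> is_derive x v f df.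
Proof.
move=> fi; have dfx : derivable f x v.
  by apply/derivable_mxP => i j; rewrite ord1; case: (fi j).
apply: DeriveDef => //; rewrite derive_mx //; apply/rowP => i; rewrite mxE.
by case: (fi i).
Qed.

Lemma is_derive_coord (V : normedModType R) n (f : V -> 'rV[R]_n)
    (x v : V) (df : 'rV[R]_n) i :
  is_derive x v f df -> is_derive x v (fun y => f y 0 i) (df 0 i).
Proof.
move=> [dfx <-]; apply: DeriveDef.
  by have /derivable_mxP := dfx; apply.
by rewrite derive_mx // mxE.
Qed.

Lemma is_derive_quad_row (V : normedModType R) (f0 f1 f2 f3 : V -> R) (x v : V)
    (d0 d1 d2 d3 : R) :
  is_derive x v f0 d0 -> is_derive x v f1 d1 ->
  is_derive x v f2 d2 -> is_derive x v f3 d3 ->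
  is_derive x v (fun y => quad_row (f0 y) (f1 y) (f2 y) (f3 y))
    (quad_row d0 d1 d2 d3).
Proof.
move=> h0 h1 h2 h3; apply: is_derive_coordinatewise => -[[|[|[|[|//]]]] i] /=;
  rewrite mxE /=; by under eq_fun do rewrite mxE /=.
Qed.

Lemma is_derive_dotv (V : normedModType R) n (f g : V -> 'rV[R]_n) (x v : V)
    (df dg : 'rV[R]_n) :
  is_derive x v f df -> is_derive x v g dg ->
  is_derive x v (fun y => dotv (f y) (g y)) (dotv df (g x) + dotv (f x) dg).
Proof.
move=> hf hg; rewrite /dotv -big_split /=.
have -> : (fun y => \sum_(i < n) f y 0 i * g y 0 i) =
          \sum_(i < n) (fun y => f y 0 i * g y 0 i).
  by apply/funext => y; rewrite fct_sumE.
apply: is_derive_sum => i.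
apply: (is_derive_eq (is_deriveM (is_derive_coord i hf) (is_derive_coord i hg))).
by rewrite /GRing.scale /=; ring.
Qed.

(* The orthonormal basis (e^{iv}, 0), (i e^{iv}, 0), (0, e^{i theta}),
   (0, i e^{i theta}) of C^2 = R^4, where x = (theta, v). *)
Definition frame (x : 'rV[R]_2) (y0 y1 y2 y3 : R) : 'rV[R]_4 :=
  let t := x 0 0 in let v := x 0 1 in
  quad_row (y0 * cos v - y1 * sin v) (y0 * sin v + y1 * cos v)
           (y2 * cos t - y3 * sin t) (y2 * sin t + y3 * cos t).

Lemma dotv_frame x y0 y1 y2 y3 z0 z1 z2 z3 :
  dotv (frame x y0 y1 y2 y3) (frame x z0 z1 z2 z3) =
  y0 * z0 + y1 * z1 + y2 * z2 + y3 * z3.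
Proof.
rewrite dotv_quad_row; have := cos2Dsin2 (x 0 0); have := cos2Dsin2 (x 0 1).
set cv := cos (x 0 1); set sv := sin (x 0 1).
set ct := cos (x 0 0); set st := sin (x 0 0) => hv ht.
transitivity ((y0 * z0 + y1 * z1) * (cv ^+ 2 + sv ^+ 2) +
  (y2 * z2 + y3 * z3) * (ct ^+ 2 + st ^+ 2)); first by ring.
by rewrite hv ht !mulr1 !addrA.
Qed.

Lemma scale_frame x s y0 y1 y2 y3 :
  s *: frame x y0 y1 y2 y3 = frame x (s * y0) (s * y1) (s * y2) (s * y3).
Proof.
by apply/rowP => -[[|[|[|[|//]]]] i]; rewrite !mxE /=; ring.
Qed.

Lemma frame_surj x (z : 'rV[R]_4) :
  exists y0 y1 y2 y3, z = frame x y0 y1 y2 y3.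
Proof.
have := cos2Dsin2 (x 0 0); have := cos2Dsin2 (x 0 1).
set cv := cos (x 0 1); set sv := sin (x 0 1).
set ct := cos (x 0 0); set st := sin (x 0 0) => hv ht.
exists (z 0 0 * cv + z 0 1 * sv), (z 0 1 * cv - z 0 0 * sv),
  (z 0 2%:R * ct + z 0 3%:R * st), (z 0 3%:R * ct - z 0 2%:R * st).
rewrite [LHS]quad_row_eta /frame -/cv -/sv -/ct -/st; congr quad_row.
- by rewrite -[LHS]mulr1 -hv; ring.
- by rewrite -[LHS]mulr1 -hv; ring.
- by rewrite -[LHS]mulr1 -ht; ring.
- by rewrite -[LHS]mulr1 -ht; ring.
Qed.

Lemma frame_inj x y0 y1 y2 y3 z0 z1 z2 z3 :
  frame x y0 y1 y2 y3 = frame x z0 z1 z2 z3 ->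
  [/\ y0 = z0, y1 = z1, y2 = z2 & y3 = z3].
Proof.
move=> e; have E w0 w1 w2 w3 := congr1 (dotv (frame x w0 w1 w2 w3)) e.
split.
- by have := E 1 0 0 0; rewrite !dotv_frame !mul1r !mul0r !addr0.
- by have := E 0 1 0 0; rewrite !dotv_frame !mul1r !mul0r !addr0 !add0r.
- by have := E 0 0 1 0; rewrite !dotv_frame !mul1r !mul0r !addr0 !add0r.
- by have := E 0 0 0 1; rewrite !dotv_frame !mul1r !mul0r !add0r.
Qed.

(** The immersion and its unit normal are both of this form, and so share one computation of
    derivatives, smoothness and periodicity. *)
Definition rotational_map (f g h : R -> R) (x : 'rV[R]_2) : 'rV[R]_4 :=
  frame x (f (x 0 0)) 0 (g (x 0 0)) (h (x 0 0)).

Lemma is_derive_rotational_map (f g h : R -> R) (df dg dh : R)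
    (x d : 'rV[R]_2) :
  is_derive (x 0 0) (1 : R) f df -> is_derive (x 0 0) (1 : R) g dg ->
  is_derive (x 0 0) (1 : R) h dh ->
  is_derive x d (rotational_map f g h)
    (frame x (d 0 0 * df) (d 0 1 * f (x 0 0)) (d 0 0 * (dg - h (x 0 0)))
             (d 0 0 * (dh + g (x 0 0)))).
Proof.
move=> hf hg hh.
have cf := is_derive_comp_coord d hf; have cg := is_derive_comp_coord d hg.
have ch := is_derive_comp_coord d hh.
have ccos (i : 'I_2) := is_derive_comp_coord d (is_derive_cos (x 0 i)).
have csin (i : 'I_2) := is_derive_comp_coord d (is_derive_sin (x 0 i)).
have c0 : is_derive x d (fun _ : 'rV[R]_2 => 0 : R) 0 by exact: is_derive_cst.
rewrite /rotational_map /frame; apply: is_derive_quad_row.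
- apply: (is_derive_eq (is_deriveB (is_deriveM cf (ccos 1))
    (is_deriveM c0 (csin 1)))).
  by rewrite /GRing.scale /=; ring.
- apply: (is_derive_eq (is_deriveD (is_deriveM cf (csin 1))
    (is_deriveM c0 (ccos 1)))).
  by rewrite /GRing.scale /=; ring.
- apply: (is_derive_eq (is_deriveB (is_deriveM cg (ccos 0))
    (is_deriveM ch (csin 0)))).
  by rewrite /GRing.scale /=; ring.
- apply: (is_derive_eq (is_deriveD (is_deriveM cg (csin 0))
    (is_deriveM ch (ccos 0)))).
  by rewrite /GRing.scale /=; ring.
Qed.

Lemma generated_rotational_map (G : set (R -> R)) (f g h : R -> R) i :
  G cos -> G sin -> generated_ring G f -> generated_ring G g ->
  generated_ring G h ->
  generated_ring (coordinate_functions G) (fun x => rotational_map f g h x 0 i).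
Proof.
move=> Gc Gs Gf Gg Gh.
have lift (j : 'I_2) q : generated_ring G q ->
    generated_ring (coordinate_functions G) (fun x => q (x 0 j)).
  apply: (@generated_comp _ _ _ G _ (fun x : 'rV[R]_2 => x 0 j)) => q' Gq'.
  by apply: generated_in; exists q' => //; exists j.
have lc j := lift j _ (generated_in Gc); have ls j := lift j _ (generated_in Gs).
have lf := lift 0 _ Gf; have lg := lift 0 _ Gg; have lh := lift 0 _ Gh.
rewrite /rotational_map /frame; case: i => -[|[|[|[|//]]]] i /=.
- apply: (generated_eq (g := fun x : 'rV[R]_2 => f (x 0 0) * cos (x 0 1))).
    by move=> x; rewrite mxE /= mul0r subr0.
  exact: generated_mul.
- apply: (generated_eq (g := fun x : 'rV[R]_2 => f (x 0 0) * sin (x 0 1))).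
    by move=> x; rewrite mxE /= mul0r addr0.
  exact: generated_mul.
- apply: (generated_eq (g := fun x : 'rV[R]_2 =>
    g (x 0 0) * cos (x 0 0) + - (h (x 0 0) * sin (x 0 0)))).
    by move=> x; rewrite mxE.
  by apply: generated_add; [|apply: generated_opp]; exact: generated_mul.
- apply: (generated_eq (g := fun x : 'rV[R]_2 =>
    g (x 0 0) * sin (x 0 0) + h (x 0 0) * cos (x 0 0))).
    by move=> x; rewrite mxE.
  by apply: generated_add; exact: generated_mul.
Qed.

Lemma is_derive_along_curve n m (f : 'rV[R]_n -> 'rV[R]_m) (c : R -> 'rV[R]_n)
    (d : 'rV[R]_n) (df : 'rV[R]_m) :
  differentiable f (c 0) -> is_derive (0 : R) (1 : R) c d ->
  is_derive (c 0) d f df ->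
  is_derive (0 : R) (1 : R) (f \o c) df.
Proof.
move=> fd [cd cE] [_ fE].
have dc : differentiable c 0 by exact/derivable1_diffP.
have dfc : differentiable (f \o c) 0 by exact: differentiable_comp.
apply: DeriveDef; first exact/derivable1_diffP.
rewrite deriveE // diff_comp //= -[X in 'd f _ X]deriveE // cE.
by rewrite -deriveE.
Qed.

Lemma is_derive_line n (x d : 'rV[R]_n) :
  is_derive (0 : R) (1 : R) (fun t : R => x + t *: d) d.
Proof.
apply: is_derive_coordinatewise => i.
have -> : (fun y : R => (x + y *: d) 0 i) = (fun y : R => x 0 i + d 0 i * y).
  by apply/funext => y; rewrite !mxE mulrC.
have h := is_deriveD (is_derive_cst (x 0 i) (0 : R) (1 : R))
  (is_deriveZ (d 0 i) (is_derive_id (0 : R) (1 : R))).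
by apply: (is_derive_eq h); rewrite add0r /GRing.scale /= mulr1.
Qed.

End frames.

(** * Surfaces of revolution *)

(* The profile curve (r, rho e^{i theta}), parametrized by theta, of a surface
   of revolution in S^3, together with the coefficients (a, 0, b, k) of its unit
   normal in [frame]. The functions [kappa] and [- a / r] are the principal
   curvatures along the meridians and the parallels. *)
Record rotational_profile (R : realType) (H : R) := RotationalProfile {
  prof_gens : set (R -> R);
  prof_r : R -> R;
  prof_rho : R -> R;
  prof_a : R -> R;
  prof_b : R -> R;
  prof_k : R -> R;
  prof_dr : R -> R;
  prof_drho : R -> R;
  prof_kappa : R -> R;
  prof_gens_closed : derivative_closed prof_gens;
  prof_gens_cos : prof_gens cos;
  prof_gens_sin : prof_gens sin;
  prof_gens_r : generated_ring prof_gens prof_r;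
  prof_gens_rho : generated_ring prof_gens prof_rho;
  prof_gens_a : generated_ring prof_gens prof_a;
  prof_gens_b : generated_ring prof_gens prof_b;
  prof_gens_k : generated_ring prof_gens prof_k;
  prof_periodic : forall x,
    [/\ prof_r (x + pi *+ 2) = prof_r x, prof_rho (x + pi *+ 2) = prof_rho x,
        prof_a (x + pi *+ 2) = prof_a x, prof_b (x + pi *+ 2) = prof_b x
      & prof_k (x + pi *+ 2) = prof_k x];
  prof_r_gt0 : forall x, 0 < prof_r x;
  prof_rho_gt0 : forall x, 0 < prof_rho x;
  prof_derive_r : forall x, is_derive x (1 : R) prof_r (prof_dr x);
  prof_derive_rho : forall x, is_derive x (1 : R) prof_rho (prof_drho x);
  prof_derive_a : forall x,
    is_derive x (1 : R) prof_a (- prof_kappa x * prof_dr x);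
  prof_derive_b : forall x,
    is_derive x (1 : R) prof_b (prof_k x - prof_kappa x * prof_drho x);
  prof_derive_k : forall x,
    is_derive x (1 : R) prof_k (- prof_b x - prof_kappa x * prof_rho x);
  prof_sphere : forall x, prof_r x ^+ 2 + prof_rho x ^+ 2 = 1;
  prof_normal_position : forall x, prof_a x * prof_r x + prof_b x * prof_rho x = 0;
  prof_normal_meridian : forall x,
    prof_a x * prof_dr x + prof_b x * prof_drho x + prof_k x * prof_rho x = 0;
  prof_normal_unit : forall x, prof_a x ^+ 2 + prof_b x ^+ 2 + prof_k x ^+ 2 = 1;
  prof_mean : forall x, prof_kappa x - prof_a x / prof_r x = H *+ 2;
  prof_nonconstant : exists x1 x2 x3,
    [/\ (prof_kappa x1 - H) ^+ 2 != (prof_kappa x2 - H) ^+ 2,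
        (prof_kappa x1 - H) ^+ 2 != (prof_kappa x3 - H) ^+ 2
      & (prof_kappa x2 - H) ^+ 2 != (prof_kappa x3 - H) ^+ 2]
}.

Section rotational_surface.
Context {R : realType} (H : R) (P : rotational_profile H).
Local Notation r := (prof_r P).
Local Notation rho := (prof_rho P).
Local Notation a := (prof_a P).
Local Notation b := (prof_b P).
Local Notation k := (prof_k P).
Local Notation dr := (prof_dr P).
Local Notation drho := (prof_drho P).
Local Notation kappa := (prof_kappa P).
Implicit Types x d : 'rV[R]_2.

Definition rot_immersion : 'rV[R]_2 -> 'rV[R]_4 := rotational_map r rho (fun=> 0).
Local Notation F := rot_immersion.

Definition rot_normal : 'rV[R]_2 -> 'rV[R]_4 := rotational_map a b k.
Local Notation n := rot_normal.

(** The differential of the immersion at [x] applied to [d]; the second and fourth coefficients come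
    from the rotation of the frame. *)
Definition rot_tangent x d : 'rV[R]_4 :=
  frame x (d 0 0 * dr (x 0 0)) (d 0 1 * r (x 0 0)) (d 0 0 * drho (x 0 0))
          (d 0 0 * rho (x 0 0)).

Definition rot_surface : set 'rV[R]_4 := range F.
Local Notation M := rot_surface.

Lemma rot_surface_image x : M (F x). Proof. by exists x. Qed.

Lemma smooth_immersion U : smooth_on U F.
Proof.
apply: (smooth_coordinate_functions (G := prof_gens P)) => [|i].
  exact: prof_gens_closed.
apply: generated_rotational_map; [exact: prof_gens_cos|exact: prof_gens_sin|
  exact: prof_gens_r|exact: prof_gens_rho|exact: generated_cst].
Qed.

Lemma smooth_normal U : smooth_on U n.
Proof.
apply: (smooth_coordinate_functions (G := prof_gens P)) => [|i].
  exact: prof_gens_closed.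
apply: generated_rotational_map; [exact: prof_gens_cos|exact: prof_gens_sin|
  exact: prof_gens_a|exact: prof_gens_b|exact: prof_gens_k].
Qed.

Lemma differentiable_immersion x : differentiable F x.
Proof. by have [+ _] := @smooth_immersion setT 1%N; apply. Qed.

Lemma differentiable_normal x : differentiable n x.
Proof. by have [+ _] := @smooth_normal setT 1%N; apply. Qed.

Lemma is_derive_immersion x d : is_derive x d F (rot_tangent x d).
Proof.
apply: is_derive_eq.
  apply: (is_derive_rotational_map d (prof_derive_r P _) (prof_derive_rho P _)).
by rewrite subr0 add0r.
Qed.

(** The coefficients of [rot_tangent] are left unsimplified, so that the shape operator is visibly
    diagonal, with eigenvalues [kappa] and [- a / r]. *)
Lemma is_derive_normal x d : is_derive x d n
  (frame x (- kappa (x 0 0) * (d 0 0 * dr (x 0 0)))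
           (- (- a (x 0 0) / r (x 0 0)) * (d 0 1 * r (x 0 0)))
           (- kappa (x 0 0) * (d 0 0 * drho (x 0 0)))
           (- kappa (x 0 0) * (d 0 0 * rho (x 0 0)))).
Proof.
apply: is_derive_eq.
  apply: (is_derive_rotational_map d (prof_derive_a P _) (prof_derive_b P _)
    (prof_derive_k P _)).
have r0 := prof_r_gt0 P (x 0 0).
congr frame; try by ring.
by rewrite !mulNr opprK mulrCA divfK // gt_eqF.
Qed.

(** The moduli of the two complex coordinates are [r] and [rho], and their arguments are the
    parameters v and theta modulo 2 pi. A profile that is a graph over theta therefore cannot meet
    itself: this is embeddedness. *)
Lemma immersion_eq x y : F x = F y ->
  exists k0 k1 : int, x 0 0 = y 0 0 + (pi *+ 2) *~ k0 /\
    x 0 1 = y 0 1 + (pi *+ 2) *~ k1.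
Proof.
move=> e; have coord i := congr1 (fun z : 'rV_4 => z 0 i) e.
have := coord 0; have := coord 1; have := coord 2%:R; have := coord 3%:R.
rewrite !mxE /= !mul0r !subr0 !addr0 => e3 e2 e1 e0.
have r0 := prof_r_gt0 P; have rho0 := prof_rho_gt0 P.
have er : r (x 0 0) = r (y 0 0).
  rewrite -(sqrt_polar (x 0 1) (ltW (r0 (x 0 0)))) e0 e1 sqrt_polar //.
  exact: ltW.
have erho : rho (x 0 0) = rho (y 0 0).
  rewrite -(sqrt_polar (x 0 0) (ltW (rho0 (x 0 0)))) e2 e3 sqrt_polar //.
  exact: ltW.
rewrite -er in e0 e1; rewrite -erho in e2 e3.
have rn : r (x 0 0) != 0 by rewrite gt_eqF.
have rhon : rho (x 0 0) != 0 by rewrite gt_eqF.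
have [k0 h0] := angle_eq_mod (mulfI rhon e2) (mulfI rhon e3).
have [k1 h1] := angle_eq_mod (mulfI rn e0) (mulfI rn e1).
by exists k0, k1.
Qed.

Lemma rotational_map_periodic (f g h : R -> R) (k0 k1 : int) x :
  (forall t, f (t + pi *+ 2) = f t) -> (forall t, g (t + pi *+ 2) = g t) ->
  (forall t, h (t + pi *+ 2) = h t) ->
  rotational_map f g h
    (pair_row (x 0 0 + (pi *+ 2) *~ k0) (x 0 1 + (pi *+ 2) *~ k1)) =
  rotational_map f g h x.
Proof.
move=> hf hg hh; rewrite /rotational_map /frame !mxE /=.
by rewrite !(periodic_int _ _ hf, periodic_int _ _ hg, periodic_int _ _ hh,
  periodic_int _ _ (@cosD2pi R), periodic_int _ _ (@sinD2pi R)).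
Qed.

Lemma immersion_periodic x (k0 k1 : int) :
  F (pair_row (x 0 0 + (pi *+ 2) *~ k0) (x 0 1 + (pi *+ 2) *~ k1)) = F x.
Proof.
by apply: rotational_map_periodic => // t; have [] := prof_periodic P t.
Qed.

Lemma normal_immersion_eq x y : F x = F y -> n x = n y.
Proof.
move=> /immersion_eq[k0 [k1 [h0 h1]]]; rewrite [x]pair_row_eta h0 h1.
by apply: rotational_map_periodic => t; have [] := prof_periodic P t.
Qed.

Lemma rot_surface_sphere : M `<=` @sphere3 R.
Proof.
move=> _ [x _ <-]; rewrite /sphere3 /= dotv_frame.
by rewrite mul0r !addr0 -!expr2 prof_sphere.
Qed.

Lemma rot_surface_compact : compact M.
Proof.
pose B := [set x : 'rV[R]_2 | forall i, `[(- pi), pi]%classic (x 0 i)].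
have -> : M = F @` B.
  apply/seteqP; split=> [_ [x _ <-]|_ [x _ <-]]; last by exists x.
  have [k0 h0] := angle_reduction (x 0 0).
  have [k1 h1] := angle_reduction (x 0 1).
  exists (pair_row (x 0 0 + (pi *+ 2) *~ k0) (x 0 1 + (pi *+ 2) *~ k1)).
    by case/andP: h0 => ? /ltW ?; case/andP: h1 => ? /ltW ?;
      move=> -[[|[|//]] i]; rewrite mxE /= in_itv /=; apply/andP.
  exact: immersion_periodic.
apply: continuous_compact.
  apply: continuous_subspaceT => x.
  exact/differentiable_continuous/differentiable_immersion.
apply: (@rV_compact R 2 (fun=> `[(- pi), pi]%classic)) => _.
exact: segment_compact.
Qed.

Lemma rot_surface_connected : connected M.
Proof.
(* The parameter plane is star-shaped about 0: the images of the segments from 0 all contain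
   [F 0]. *)
have -> : M = \bigcup_x ((fun t : R => F (t *: x)) @` `[0, 1]%classic).
  apply/seteqP; split=> [_ [x _ <-]|_ [x _ [t _ <-]]]; last by exists (t *: x).
  by exists x => //; exists 1; rewrite ?scale1r //= in_itv /= lexx ler01.
apply: bigcup_connected.
  exists (F 0) => x _; exists 0; rewrite ?scale0r //= in_itv /= lexx ler01 //.
move=> x _; apply: connected_continuous_connected; first exact: segment_connected.
apply: continuous_subspaceT => t.
apply: (@continuous_comp _ _ _ (fun t : R => t *: x)).
  exact: scalel_continuous.
exact/differentiable_continuous/differentiable_immersion.
Qed.

Definition chart_box x : set 'rV[R]_2 :=
  [set y | - pi < y 0 0 - x 0 0 < pi /\ - pi < y 0 1 - x 0 1 < pi].

Definition rotate_re (t u v : R) := u * cos t + v * sin t.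
Definition rotate_im (t u v : R) := v * cos t - u * sin t.

(** The denominator in [angle]. It is nonnegative and vanishes exactly on the closed negative real
    half-axis, so its positivity describes the slit plane. *)
Definition angle_den (u v : R) := Num.sqrt (u ^+ 2 + v ^+ 2) + u.

Definition chart_open x : set 'rV[R]_4 := [set p |
  0 < angle_den (rotate_re (x 0 0) (p 0 2%:R) (p 0 3%:R))
                (rotate_im (x 0 0) (p 0 2%:R) (p 0 3%:R)) /\
  0 < angle_den (rotate_re (x 0 1) (p 0 0) (p 0 1))
                (rotate_im (x 0 1) (p 0 0) (p 0 1))].

Definition chart_inverse x (p : 'rV[R]_4) : 'rV[R]_2 := pair_row
  (x 0 0 + angle (rotate_re (x 0 0) (p 0 2%:R) (p 0 3%:R))
                 (rotate_im (x 0 0) (p 0 2%:R) (p 0 3%:R)))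
  (x 0 1 + angle (rotate_re (x 0 1) (p 0 0) (p 0 1))
                 (rotate_im (x 0 1) (p 0 0) (p 0 1))).

Lemma rotate_polar t s u :
  rotate_re t (s * cos u) (s * sin u) = s * cos (u - t) /\
  rotate_im t (s * cos u) (s * sin u) = s * sin (u - t).
Proof. by rewrite /rotate_re /rotate_im cosB sinB; split; ring. Qed.

Lemma immersion_coord x : [/\ F x 0 0 = r (x 0 0) * cos (x 0 1),
  F x 0 1 = r (x 0 0) * sin (x 0 1), F x 0 2%:R = rho (x 0 0) * cos (x 0 0)
  & F x 0 3%:R = rho (x 0 0) * sin (x 0 0)].
Proof. by rewrite !mxE /= !mul0r !subr0 !addr0. Qed.

Lemma angle_den_polar s t : 0 < s ->
  angle_den (s * cos t) (s * sin t) = s * (1 + cos t).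
Proof. by move=> s0; rewrite /angle_den sqrt_polar ?ltW // mulrDr mulr1. Qed.

Lemma chart_open_immersion x y : chart_open x (F y) <->
  0 < 1 + cos (y 0 0 - x 0 0) /\ 0 < 1 + cos (y 0 1 - x 0 1).
Proof.
have r0 := prof_r_gt0 P (y 0 0); have rho0 := prof_rho_gt0 P (y 0 0).
rewrite /chart_open /=; have [-> -> -> ->] := immersion_coord y.
have [-> ->] := rotate_polar (x 0 0) (rho (y 0 0)) (y 0 0).
have [-> ->] := rotate_polar (x 0 1) (r (y 0 0)) (y 0 1).
by rewrite !angle_den_polar // !pmulr_rgt0.
Qed.

Lemma chart_inverseK x y : chart_box x y -> chart_inverse x (F y) = y.
Proof.
move=> [h0 h1].
have r0 := prof_r_gt0 P (y 0 0); have rho0 := prof_rho_gt0 P (y 0 0).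
rewrite /chart_inverse; have [-> -> -> ->] := immersion_coord y.
have [-> ->] := rotate_polar (x 0 0) (rho (y 0 0)) (y 0 0).
have [-> ->] := rotate_polar (x 0 1) (r (y 0 0)) (y 0 1).
by rewrite !angle_polar // !subrKC -pair_row_eta.
Qed.

Lemma chart_image x : F @` chart_box x = M `&` chart_open x.
Proof.
apply/seteqP; split=> [_ [y [h0 h1] <-]|_ [[y _ <-]]].
  split; first exact: rot_surface_image.
  by apply/chart_open_immersion; split; exact: onePcos_gt0.
rewrite chart_open_immersion => -[h0 h1].
have [k0 e0] := angle_reduction (y 0 0 - x 0 0).
have [k1 e1] := angle_reduction (y 0 1 - x 0 1).
exists (pair_row (y 0 0 + (pi *+ 2) *~ k0) (y 0 1 + (pi *+ 2) *~ k1)); last first.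
  exact: immersion_periodic.
(* The reduction lands in a half-open interval; its end - pi is excluded because 1 + cos vanishes
   there. *)
have strict (u : R) k' : 0 < 1 + cos u -> - pi <= u + (pi *+ 2) *~ k' < pi ->
    - pi < u + (pi *+ 2) *~ k' < pi.
  move=> hu /andP[l ->]; rewrite andbT lt_neqAle l andbT.
  apply: contraTneq hu => e.
  rewrite -(periodic_int k' u (@cosD2pi R)) -e cosN cospi subrr ltxx //.
by split; rewrite mxE /= addrAC; exact: strict.
Qed.

Lemma chart_box_open x : open (chart_box x).
Proof.
have -> : chart_box x =
    (fun y : 'rV[R]_2 => y 0 0 - x 0 0) @^-1` `](- pi), pi[%classic `&`
    (fun y : 'rV[R]_2 => y 0 1 - x 0 1) @^-1` `](- pi), pi[%classic.
  by apply/seteqP; split=> y; rewrite /chart_box /= !in_itv.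
apply: openI; apply: open_comp; rewrite ?interval_open // => y _;
  apply: continuousB; [exact: coord_continuous|exact: cst_continuous|
    exact: coord_continuous|exact: cst_continuous].
Qed.

Lemma differentiable_rotate t (i j : 'I_4) (p : 'rV[R]_4) :
  differentiable (fun q : 'rV[R]_4 => rotate_re t (q 0 i) (q 0 j)) p /\
  differentiable (fun q : 'rV[R]_4 => rotate_im t (q 0 i) (q 0 j)) p.
Proof.
have d l := @differentiable_coord R 1 4 p 0 l.
by split; [apply: differentiableD|apply: differentiableB];
  apply: differentiableM => //; exact: differentiable_cst.
Qed.

Lemma chart_open_open x : open (chart_open x).
Proof.
have den t i j : continuous (fun q : 'rV[R]_4 =>
    angle_den (rotate_re t (q 0 i) (q 0 j)) (rotate_im t (q 0 i) (q 0 j))).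
  move=> q; have [d1 d2] := differentiable_rotate t i j q.
  apply: (@continuousD _ _ _ (fun q : 'rV[R]_4 => Num.sqrt
    (rotate_re t (q 0 i) (q 0 j) ^+ 2 + rotate_im t (q 0 i) (q 0 j) ^+ 2))).
    apply: (@continuous_comp _ _ _ (fun q : 'rV[R]_4 =>
      rotate_re t (q 0 i) (q 0 j) ^+ 2 + rotate_im t (q 0 i) (q 0 j) ^+ 2)).
      by apply: differentiable_continuous; apply: differentiableD;
        exact: differentiable_sqr.
    exact: sqrt_continuous.
  exact: differentiable_continuous.
have op t i j : open [set q : 'rV[R]_4 | 0 <
    angle_den (rotate_re t (q 0 i) (q 0 j)) (rotate_im t (q 0 i) (q 0 j))].
  apply: (@open_comp _ _ (fun q : 'rV[R]_4 => angle_den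
    (rotate_re t (q 0 i) (q 0 j)) (rotate_im t (q 0 i) (q 0 j))) [set u | 0 < u]).
    by move=> q _; exact: den.
  exact: open_gt.
exact: (openI (op (x 0 0) 2%:R 3%:R) (op (x 0 1) 0 1)).
Qed.

Lemma differentiable_chart_inverse x p :
  chart_open x p -> differentiable (chart_inverse x) p.
Proof.
move=> [h0 h1]; apply: differentiable_coordinatewise => -[[|[|//]] i] /=;
  under eq_fun do rewrite mxE /=.
  have [d1 d2] := differentiable_rotate (x 0 0) 2%:R 3%:R p.
  by apply: differentiableD; [exact: differentiable_cst|exact: differentiable_angle].
have [d1 d2] := differentiable_rotate (x 0 1) 0 1 p.
by apply: differentiableD; [exact: differentiable_cst|exact: differentiable_angle].
Qed.

Lemma tangent_eq0 x d : rot_tangent x d = 0 -> d = 0.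
Proof.
have r0 := prof_r_gt0 P (x 0 0); have rho0 := prof_rho_gt0 P (x 0 0).
have e0 : 0 = frame x 0 0 0 0.
  by rewrite -[LHS](scale0r (frame x 0 0 0 0)) scale_frame mul0r.
rewrite e0 => /frame_inj[_ /eqP + _ /eqP]; rewrite !mulf_eq0.
rewrite (gt_eqF r0) (gt_eqF rho0) !orbF => /eqP d1 /eqP d0.
by rewrite [d]pair_row_eta d0 d1; apply/rowP => -[[|[|//]] i]; rewrite !mxE.
Qed.

Lemma chart_parametrization x :
  local_parametrization M (chart_box x) (chart_open x) F /\ chart_open x (F x).
Proof.
have box : chart_box x x by rewrite /chart_box /= !subrr oppr_lt0 pi_gt0.
split; last first.
  by have := imageP F box; rewrite chart_image => -[].
split.
- by split; [exact: chart_box_open|exact: chart_open_open].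
- exact: smooth_immersion.
- move=> u _ d e /eqP; rewrite -subr_eq0 -linearB /= => /eqP h.
  apply/eqP; rewrite -subr_eq0; apply/eqP/(@tangent_eq0 u).
  have [_ <-] := is_derive_immersion u (d - e).
  by rewrite deriveE //; exact: differentiable_immersion.
- exact: chart_image.
- exists (chart_inverse x); split; last exact: chart_inverseK.
  apply: continuous_in_subspaceT => p; rewrite inE => -[_ op].
  exact/differentiable_continuous/differentiable_chart_inverse.
Qed.

Lemma rot_surface_embedded : embedded_compact_surface M.
Proof.
split.
- by exists (F 0); exact: rot_surface_image.
- exact: rot_surface_compact.
- exact: rot_surface_connected.
- exact: rot_surface_sphere.
- move=> _ [x _ <-]; exists (chart_box x), (chart_open x), F.
  exact: chart_parametrization.
Qed.

(* Curves in M lift through the immersion because the inverse chart is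
   differentiable. *)
Lemma curve_lift x w c : curve_through M (F x) w c ->
  exists g d, [/\ g 0 = x, is_derive (0 : R) (1 : R) g d,
    w = rot_tangent x d & \forall t \near (0 : R), c t = F (g t)].
Proof.
move=> [c0 Mc dc]; have [_ opx] := chart_parametrization x.
have box : chart_box x x by rewrite /chart_box /= !subrr oppr_lt0 pi_gt0.
have derc : derivable c 0 1 by case: dc.
have cc : {for 0, continuous c}.
  exact/differentiable_continuous/derivable1_diffP.
have oc : \forall t \near (0 : R), chart_open x (c t).
  apply: (cc (chart_open x)); apply: open_nbhs_nbhs; split.
    exact: chart_open_open.
  by rewrite c0.
pose g := chart_inverse x \o c.
have lift : \forall t \near (0 : R), c t = F (g t).
  near=> t.
  have Mt : M (c t) by near: t.
  have ot : chart_open x (c t) by near: t.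
  have [y hy e] : (F @` chart_box x) (c t) by rewrite chart_image.
  by rewrite /g /= -e chart_inverseK.
have gx : g 0 = x by rewrite /g /= c0 chart_inverseK.
have dg : derivable g 0 1.
  apply/derivable1_diffP/differentiable_comp; first exact/derivable1_diffP.
  by apply: differentiable_chart_inverse; rewrite c0.
have dg' : is_derive (0 : R) (1 : R) g ('D_1 g 0) by exact: derivableP.
exists g, ('D_1 g 0); split => //.
have dFg : is_derive (0 : R) (1 : R) (F \o g) (rot_tangent x ('D_1 g 0)).
  apply: (is_derive_along_curve _ dg'); first exact: differentiable_immersion.
  by rewrite gx; exact: is_derive_immersion.
have := near_eq_is_derive lift dc; case: dFg => _ <- [_ <-] //.
Unshelve. all: by end_near. Qed.

Lemma curve_line x d : curve_through M (F x) (rot_tangent x d)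
  (fun t => F (x + t *: d)).
Proof.
split.
- by rewrite scale0r addr0.
- by near=> t; exact: rot_surface_image.
- apply: (is_derive_along_curve _ (is_derive_line x d));
    rewrite scale0r addr0; [exact: differentiable_immersion|].
  exact: is_derive_immersion.
Unshelve. all: by end_near. Qed.

End rotational_surface.

(** * Curvature of surfaces of revolution *)

Section curvature.
Context {R : realType} (H : R) (P : rotational_profile H).
Local Notation r := (prof_r P).
Local Notation rho := (prof_rho P).
Local Notation a := (prof_a P).
Local Notation b := (prof_b P).
Local Notation k := (prof_k P).
Local Notation dr := (prof_dr P).
Local Notation drho := (prof_drho P).
Local Notation kappa := (prof_kappa P).
Local Notation F := (rot_immersion P).
Local Notation n := (rot_normal P).
Local Notation M := (rot_surface P).
Implicit Types x d : 'rV[R]_2.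

(** The choice of preimage is harmless: the normal takes the same value at all preimages of a
    point. *)
Definition rot_normal_field (p : 'rV[R]_4) : 'rV[R]_4 :=
  n (xget 0 [set x | F x = p]).

Lemma rot_normal_fieldE x : rot_normal_field (F x) = n x.
Proof.
apply: normal_immersion_eq.
by have := @xgetPex _ 0 [set y | F y = F x] (ex_intro _ x erefl).
Qed.

Lemma rot_normal_unit x : dotv (n x) (n x) = 1.
Proof.
by rewrite dotv_frame mulr0 addr0 -!expr2 prof_normal_unit.
Qed.

Lemma rot_normal_tangent x d : dotv (n x) (rot_tangent P x d) = 0.
Proof.
rewrite dotv_frame mul0r addr0 -[RHS](mulr0 (d 0 0)).
by rewrite -(prof_normal_meridian P (x 0 0)); ring.
Qed.

Lemma rot_unit_normal_field : unit_normal_field M rot_normal_field.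
Proof.
split=> _ [x _ <-].
  rewrite rot_normal_fieldE; split; first exact: rot_normal_unit.
    by rewrite dotv_frame !mulr0 !addr0 prof_normal_position.
  move=> w [c /curve_lift[g [d [_ _ -> _]]]]; exact: rot_normal_tangent.
exists (chart_box x), (chart_open x), F; have [h o] := chart_parametrization P x.
split=> //; have -> : rot_normal_field \o F = n.
  by apply/funext => y; exact: rot_normal_fieldE.
exact: smooth_normal.
Qed.

Lemma rot_shape_operator x d l :
  [\/ d 0 1 = 0 /\ l = kappa (x 0 0) |
      d 0 0 = 0 /\ l = - a (x 0 0) / r (x 0 0)] ->
  shape_operator M rot_normal_field (F x) (rot_tangent P x d)
    (l *: rot_tangent P x d).
Proof.
move=> hd; exists (fun t : R => F (x + t *: d)); split; first exact: curve_line.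
have -> : rot_normal_field \o (fun t : R => F (x + t *: d)) =
    n \o (fun t : R => x + t *: d).
  by apply/funext => t; exact: rot_normal_fieldE.
apply: (is_derive_along_curve _ (is_derive_line x d));
  rewrite scale0r addr0; first exact: differentiable_normal.
apply: (is_derive_eq (is_derive_normal P x d)).
rewrite -[RHS]scaleNr scale_frame.
by case: hd => -[-> ->]; rewrite !(mul0r, mulr0).
Qed.

Lemma rot_mean_curvature p : M p -> mean_curvature M rot_normal_field p H.
Proof.
move=> [x _ <-]; exists (kappa (x 0 0)), (- a (x 0 0) / r (x 0 0)).
have r0 := prof_r_gt0 P (x 0 0); have rho0 := prof_rho_gt0 P (x 0 0).
split; last by rewrite mulNr prof_mean; field.
(* [s2] is the squared speed of the profile; [d1] and [d2] below are the meridian and parallel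
   directions scaled to unit length. *)
pose s2 := dr (x 0 0) ^+ 2 + drho (x 0 0) ^+ 2 + rho (x 0 0) ^+ 2.
have s2_gt0 : 0 < s2 by rewrite ltr_wpDl ?addr_ge0 ?sqr_ge0 // exprn_gt0.
pose s := Num.sqrt s2; have s_gt0 : 0 < s by rewrite sqrtr_gt0.
have sE : s ^+ 2 = s2 by rewrite sqr_sqrtr // ltW.
pose d1 := pair_row s^-1 (0 : R); pose d2 := pair_row 0 (r (x 0 0))^-1.
exists (rot_tangent P x d1), (rot_tangent P x d2); split.
- rewrite dotv_frame !mxE /= !mul0r addr0.
  transitivity (s^-1 ^+ 2 * s2); first by rewrite /s2; ring.
  by rewrite -sE exprVn mulVf // expf_neq0 // gt_eqF.
- rewrite dotv_frame !mxE /= !mul0r !addr0 add0r mulVf ?mulr1 // gt_eqF //.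
- by rewrite dotv_frame !mxE /= !mul0r !mulr0 !addr0.
- by apply: rot_shape_operator; left; rewrite !mxE.
- by apply: rot_shape_operator; right; rewrite !mxE.
Qed.

Lemma rot_surface_cmc : has_constant_mean_curvature M H.
Proof.
exists rot_normal_field; split; first exact: rot_unit_normal_field.
by move=> p; exact: rot_mean_curvature.
Qed.

(** The position and the two coordinate tangents leave a single line of normals in R^4. In frame
    coordinates, [N] and [n] satisfy the same linear relations expressing everything through the
    third coefficient, which cannot vanish for [n]. *)
Lemma unit_normal_parallel N x : unit_normal_field M N ->
  N (F x) = dotv (N (F x)) (n x) *: n x /\ dotv (N (F x)) (n x) ^+ 2 = 1.
Proof.
move=> [/(_ _ (rot_surface_image P x))[Nunit Npos Ntan] _].
have r0 := prof_r_gt0 P (x 0 0); have rho0 := prof_rho_gt0 P (x 0 0).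
have tan d := Ntan _ (ex_intro _ _ (curve_line P x d)).
have [y0 [y1 [y2 [y3 E]]]] := frame_surj x (N (F x)).
have := tan (pair_row 1 0); have := tan (pair_row 0 1); move: Npos.
rewrite E !dotv_frame !mxE /= !mul0r !mul1r !mulr0 !addr0 !add0r.
move=> hpos /eqP; rewrite mulf_eq0 (gt_eqF r0) orbF => /eqP y10 hmer.
have := prof_normal_position P (x 0 0); have := prof_normal_meridian P (x 0 0).
have := prof_normal_unit P (x 0 0).
move: Nunit; rewrite E !dotv_frame y10 !mul0r !addr0 => hun.
move: hpos hmer hun r0 rho0.
set ax := a _; set bx := b _; set kx := k _; set rx := r _; set px := rho _.
set drx := dr _; set dpx := drho _ => hpos hmer hun r0 rho0 nun nmer npos.
have rn : rx != 0 by rewrite gt_eqF.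
have pn : px != 0 by rewrite gt_eqF.
have y0E : y0 = - y2 * px / rx.
  apply: (mulIf rn); rewrite divfK //; apply/eqP; rewrite -subr_eq0 -hpos.
  by apply/eqP; ring.
have axE : ax = - bx * px / rx.
  apply: (mulIf rn); rewrite divfK //; apply/eqP; rewrite -subr_eq0 -npos.
  by apply/eqP; ring.
(* The ratio of the fourth to the third coefficient forced by orthogonality to the position and to
   the meridian. *)
pose m := (drx - dpx * rx / px) / rx.
have y3E : y3 = y2 * m.
  apply: (mulIf pn); apply/eqP; rewrite -subr_eq0 -[X in _ == X]hmer y0E /m.
  by apply/eqP; field; rewrite ?rn ?pn.
have kxE : kx = bx * m.
  apply: (mulIf pn); apply/eqP; rewrite -subr_eq0 -[X in _ == X]nmer axE /m.
  by apply/eqP; field; rewrite ?rn ?pn.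
have bn : bx != 0.
  apply: contraPneq nun => b0; rewrite axE kxE b0 oppr0 !mul0r !expr0n /= !addr0.
  by move=> /esym/eqP; rewrite oner_eq0.
have [s [s0 s2 s3]] : exists s, [/\ y0 = s * ax, y2 = s * bx & y3 = s * kx].
  exists (y2 / bx); rewrite y0E y3E axE kxE; split; [|by rewrite divfK|].
    by field; rewrite ?rn ?bn.
  by field; rewrite ?rn ?bn ?pn.
have -> : y0 * ax + y2 * bx + y3 * kx = s.
  by rewrite s0 s2 s3 -[RHS]mulr1 -nun; ring.
split; last first.
  by rewrite -hun s0 s2 s3 -[LHS]mulr1 -nun; ring.
by rewrite scale_frame -/ax -/bx -/kx s0 s2 s3 mulr0.
Qed.

(** Along a lifted curve, [N] equals [n] up to a sign whose derivative vanishes, so the two shape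
    operators agree up to that sign. *)
Lemma principal_curvature_rot N x e l : unit_normal_field M N -> e != 0 ->
  shape_operator M N (F x) e (l *: e) ->
  exists2 s : R, s ^+ 2 = 1 &
    l = s * kappa (x 0 0) \/ l = s * (- a (x 0 0) / r (x 0 0)).
Proof.
move=> NM e0 [c [cthr dNc]].
have [g [d [g0 dg eE lift]]] := curve_lift cthr.
have r0 := prof_r_gt0 P (x 0 0); have rho0 := prof_rho_gt0 P (x 0 0).
have dng : is_derive (0 : R) (1 : R) (n \o g) (frame x
    (- kappa (x 0 0) * (d 0 0 * dr (x 0 0)))
    (- (- a (x 0 0) / r (x 0 0)) * (d 0 1 * r (x 0 0)))
    (- kappa (x 0 0) * (d 0 0 * drho (x 0 0)))
    (- kappa (x 0 0) * (d 0 0 * rho (x 0 0)))).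
  apply: (is_derive_along_curve _ dg); first exact: differentiable_normal.
  by rewrite g0; exact: is_derive_normal.
set dn := frame _ _ _ _ _ in dng.
(* Writing the sign as an inner product makes it differentiable, since both factors are
   differentiable along the curve. *)
pose s t := dotv (N (c t)) (n (g t)).
have par : \forall t \near (0 : R), N (c t) = s t *: n (g t) /\ s t ^+ 2 = 1.
  near=> t; rewrite /s (_ : c t = F (g t)); last by near: t.
  exact: unit_normal_parallel.
have [par0 s01] := nbhs_singleton par.
have [ds0 dsE] : exists ds0, is_derive (0 : R) (1 : R) s ds0.
  by eexists; exact: (is_derive_dotv dNc dng).
(* s^2 is constant, hence s' = 0 at 0. *)
have ds00 : ds0 = 0.
  have h1 := is_deriveM dsE dsE.
  have h2 : is_derive (0 : R) (1 : R) (s * s) 0.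
    apply: (near_eq_is_derive _ (is_derive_cst (1 : R) (0 : R) (1 : R))).
    near=> t.
    have [_ e2] : N (c t) = s t *: n (g t) /\ s t ^+ 2 = 1 by near: t.
    by rewrite -[LHS]e2 expr2.
  case: h1 => _; case: h2 => _ -> /esym/eqP.
  rewrite /GRing.scale /= -mulr2n mulrn_eq0 /= mulf_eq0 => /orP[/eqP s00|/eqP //].
  by move: s01; rewrite s00 expr0n /= => /esym/eqP; rewrite oner_eq0.
have key : - (l *: e) = s 0 *: dn.
  have h : is_derive (0 : R) (1 : R) (fun t => s t *: (n \o g) t) (s 0 *: dn).
    apply: is_derive_coordinatewise => i.
    have -> : (fun t => (s t *: (n \o g) t) 0 i) =
        (fun t => s t * ((n \o g) t) 0 i).
      by apply/funext => t; rewrite mxE.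
    apply: (is_derive_eq (is_deriveM dsE (is_derive_coord i dng))).
    by rewrite ds00 scaler0 addr0 [RHS]mxE.
  have h' : is_derive (0 : R) (1 : R) (N \o c) (s 0 *: dn).
    apply: (near_eq_is_derive _ h); near=> t.
    have [e1 _] : N (c t) = s t *: n (g t) /\ s t ^+ 2 = 1 by near: t.
    by rewrite /= e1.
  by case: dNc => _ <-; case: h'.
exists (s 0) => //.
move: key; rewrite -[X in X = _]scaleNr eE /dn !scale_frame => /frame_inj[_ h1 _ h3].
move: (s 0) h1 h3 => s0 h1 h3.
have h1' : (l - s0 * (- a (x 0 0) / r (x 0 0))) * (d 0 1 * r (x 0 0)) = 0.
  by move/eqP: h1; rewrite -subr_eq0 -oppr_eq0 => /eqP <-; ring.
have h3' : (l - s0 * kappa (x 0 0)) * (d 0 0 * rho (x 0 0)) = 0.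
  by move/eqP: h3; rewrite -subr_eq0 -oppr_eq0 => /eqP <-; ring.
have dn0 : (d 0 0 != 0) || (d 0 1 != 0).
  rewrite -negb_and; apply: contra e0 => /andP[/eqP d0 /eqP d1].
  rewrite eE /rot_tangent d0 d1 !mul0r.
  by rewrite -(scale0r (frame x 0 0 0 0)) scale_frame mul0r.
case/orP: dn0 => dn0.
  left; apply/eqP; rewrite -subr_eq0; move/eqP: h3'.
  by rewrite mulf_eq0 mulf_eq0 (negbTE dn0) (gt_eqF rho0) !orbF.
right; apply/eqP; rewrite -subr_eq0; move/eqP: h1'.
by rewrite mulf_eq0 mulf_eq0 (negbTE dn0) (gt_eqF r0) !orbF.
Unshelve. all: by end_near. Qed.

Lemma rot_surface_not_isoparametric : ~ isoparametric M.
Proof.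
move=> [N [NM [k1 [k2 prin]]]].
(* The curvatures [kappa] and 2 H - [kappa] are symmetric about H, so squaring the deviation removes
   the choice between them; the sign of the normal turns H into - H. *)
have key t : ((k1 - H) ^+ 2 == (kappa t - H) ^+ 2) ||
             ((k1 + H) ^+ 2 == (kappa t - H) ^+ 2).
  pose x := pair_row t 0.
  have [e1 [e2 [e11 _ _ sh _]]] := prin _ (rot_surface_image P x).
  have e1n : e1 != 0.
    apply: contraPneq e11 => ->; rewrite /dotv big1 => [/esym/eqP|i _].
      by rewrite oner_eq0.
    by rewrite mxE mul0r.
  have [s /eqP] := principal_curvature_rot NM e1n sh.
  have -> : x 0 0 = t by rewrite mxE.
  have lE : - a t / r t = H *+ 2 - kappa t by rewrite -(prof_mean P t); ring.
  rewrite lE sqrf_eq1 => /orP[] /eqP -> [] ->.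
  - by rewrite mul1r eqxx.
  - by apply/orP; left; apply/eqP; ring.
  - by apply/orP; right; apply/eqP; ring.
  - by apply/orP; right; apply/eqP; ring.
have [x1 [x2 [x3 [/eqP n12 /eqP n13 /eqP n23]]]] := prof_nonconstant P.
have := key x1; have := key x2; have := key x3.
by do 3 (move=> /orP[] /eqP ?); congruence.
Qed.

End curvature.

(** * Antiderivatives of periodic functions *)

Section antiderivative.
Context {R : realType}.
Notation mu := (@lebesgue_measure R).
Implicit Types g G : R -> R.

Lemma continuous_integrable_segment g a b : continuous g ->
  mu.-integrable `[a, b]%classic (EFin \o g).
Proof.
move=> cg; apply: continuous_compact_integrable; first exact: segment_compact.
exact: continuous_subspaceT.
Qed.

(** The fundamental theorem is applied from a fixed left end point. The signed integral from 0
    differs from such an integral by a constant near each [t]. *)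
Lemma exists_antiderivative g : continuous g ->
  exists G, forall t, is_derive t (1 : R) G (g t).
Proof.
move=> cg; pose I a t := \int[mu]_(s in `[a, t]) g s.
pose G t := if 0 <= t then \int[mu]_(s in `]0, t]) g s
            else - \int[mu]_(s in `]t, 0]) g s.
have GE a t : a < 0 -> a < t -> G t = I a t - I a 0.
  move=> a0 at_; rewrite /G /I; case: ifPn => t0.
    rewrite Rintegral_itvB // ?bnd_simp ?ltW //.
    exact: continuous_integrable_segment.
  rewrite -ltNge in t0; rewrite -[RHS]opprB Rintegral_itvB // ?bnd_simp ?ltW //.
  exact: continuous_integrable_segment.
(* A base point to the left of both 0 and [t]. *)
exists G => t; pose a := - (`|t| + 1).
have a0 : a < 0 by rewrite /a oppr_lt0 ltr_wpDl.
have at_ : a < t.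
  by rewrite /a ltrNl (le_lt_trans (ler_norm _)) // normrN ltrDl.
have [dI IE] := @continuous_FTC1_closed _ g a t (t + 1)
  ltac:(by rewrite ltrDl) (continuous_integrable_segment _ _ cg) at_ (cg t).
have dIa : is_derive t (1 : R) (I a) (g t).
  by apply: DeriveDef => //; rewrite -derive1E IE.
apply: (near_eq_is_derive (f := fun s => I a s - I a 0)).
  near=> s; rewrite (GE a) //; near: s; exact: (cvgr_gt t).
apply: (is_derive_eq (is_deriveB dIa (is_derive_cst (I a 0) t (1 : R)))).
by rewrite subr0.
Unshelve. all: by end_near. Qed.

Lemma integral_derivative g G a b : a < b -> continuous g ->
  (forall t, is_derive t (1 : R) G (g t)) ->
  \int[mu]_(t in `]a, b[) g t = G b - G a.
Proof.
move=> ab cg dG; have intg := continuous_integrable_segment a b cg.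
have cG t : {for t, continuous G}.
  by apply: differentiable_continuous; apply/derivable1_diffP; case: (dG t).
rewrite Rintegral_itv_bndo_bndc; last first.
  by apply: (integrableS _ _ _ intg) => //; exact: subset_itv_oo_cc.
rewrite Rintegral_itv_obnd_cbnd; last first.
  by apply: (integrableS _ _ _ intg) => //; exact: subset_itv_oc_cc.
rewrite /Rintegral (continuous_FTC2 (F := G) ab) //=.
- exact: continuous_subspaceT.
- split.
  + by move=> t _; case: (dG t).
  + by apply: cvg_at_right_filter; exact: cG.
  + by apply: cvg_at_left_filter; exact: cG.
- by move=> t _; rewrite derive1E; case: (dG t).
Qed.

(** The increment over a period has derivative zero, so it may be computed on any period, in
    particular from - pi to pi. *)
Lemma antiderivative_periodic g G p : (forall t, is_derive t (1 : R) G (g t)) ->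
  (forall t, g (t + p) = g t) -> forall t s, G (t + p) - G t = G (s + p) - G s.
Proof.
move=> dG gp t s; apply: (@is_derive_0_is_cst _ (fun u => G (u + p) - G u)) => u.
have h1 : is_derive u (1 : R) (fun v => v + p) 1.
  apply: (is_derive_eq (is_deriveD (is_derive_id u (1 : R))
    (is_derive_cst p u (1 : R)))).
  by rewrite addr0.
have h2 := @is_derive1_comp _ G (fun v => v + p) u _ _ (dG (u + p)) h1.
by apply: (is_derive_eq (is_deriveB h2 (dG u))); rewrite mulr1 gp subrr.
Qed.

(* Quasi-periodicity makes G proper, hence onto. *)
Lemma exists_inverse g G p q : (forall t, is_derive t (1 : R) G (g t)) ->
  (forall t, 0 < g t) -> 0 < p -> 0 < q -> (forall t, G (t + p) = G t + q) ->
  exists S, [/\ cancel G S, cancel S G &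
    forall y, is_derive y (1 : R) S (g (S y))^-1].
Proof.
move=> dG g0 p0 q0 Gp.
have cG t : {for t, continuous G}.
  by apply: differentiable_continuous; apply/derivable1_diffP; case: (dG t).
have Gmono x y : x < y -> G x < G y.
  move=> xy; have [|c _ e] := @MVT _ G g x y xy (fun t _ => dG t).
    by apply: continuous_subspaceT => t; exact: cG.
  by rewrite -subr_gt0 e mulr_gt0 ?subr_gt0.
have Ginj : injective G.
  move=> x y; have [/Gmono|/Gmono|//] := ltgtP x y => h e; move: h;
    by rewrite e ltxx.
have Gsurj y : exists t, G t = y.
  have GnE n : G (p *+ n) = G 0 + q *+ n.
    elim: n => [|n IH]; first by rewrite !mulr0n addr0.
    by rewrite !mulrSr Gp IH addrA.
  have GNnE n : G (- (p *+ n)) = G 0 - q *+ n.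
    elim: n => [|n IH]; first by rewrite !mulr0n oppr0 addr0.
    apply: (addIr q); rewrite -Gp !mulrSr !opprD !addrNK IH; ring.
  pose n := (Num.truncn (`|y - G 0| / q)).+1.
  have hn : `|y - G 0| < q *+ n.
    rewrite -mulr_natl -ltr_pdivrMr // /n.
    exact: truncnS_gt.
  have [|||t _ <-] := @IVT _ G (- (p *+ n)) (p *+ n) y; last by exists t.
  - by rewrite (@le_trans _ _ 0) ?oppr_le0 ?mulrn_wge0 ?ltW.
  - by apply: continuous_subspaceT => t; exact: cG.
  - rewrite GnE GNnE; move: hn; rewrite ltr_norml => /andP[h1 h2].
    by rewrite ge_min le_max; apply/andP; split; apply/orP; [left|right]; lra.
pose S y := xget 0 [set t | G t = y].
have SK : cancel S G.
  by move=> y; have := @xgetPex _ 0 [set t | G t = y] (Gsurj y).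
have GK : cancel G S by move=> t; apply: Ginj; rewrite SK.
exists S; split=> // y; rewrite -{1}(SK y).
apply: (@is_derive_inverse _ G S (g (S y)) (S y)).
- by near=> t.
- by near=> t; exact: cG.
- by rewrite gt_eqF.
Unshelve. all: by end_near. Qed.

End antiderivative.

(** * Delaunay profiles *)

(* In spherical terms, [delaunay_cos] is the cosine of the side opposite to the
   angle pi - t in a triangle with sides phi and e; [delaunay_sq] is r^2. *)
Section delaunay.
Context {R : realType}.
Implicit Types phi e t : R.

Lemma pihalf_gt0 : 0 < pi / 2 :> R.
Proof. by rewrite divr_gt0 // pi_gt0. Qed.

Definition delaunay_cos phi e t : R := cos phi * cos e - sin phi * sin e * cos t.
(** If E is the angle of the triangle between the sides phi and c, this is sin c cos E, and sin e
    sin t is sin c sin E. Since sin c = 2 r rho, the unit normal has coefficients rho cos E, - r cos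
    E and sin E, and E is the inclination of the profile to the curves of constant r. *)
Definition delaunay_slope phi e t : R := sin phi * cos e + cos phi * sin e * cos t.
Definition delaunay_sq phi e t : R := (1 - delaunay_cos phi e t) / 2.
(** The derivative of theta with respect to t. *)
Definition delaunay_speed phi e t : R :=
  sin phi / 4 * (delaunay_slope phi e t /
    (Num.sqrt (delaunay_sq phi e t) * (1 - delaunay_sq phi e t))).

(** The three squared terms are the coordinates of the unit vector (cos e, sin e cos t, sin e sin t)
    after a rotation by phi in the first two. *)
Lemma delaunay_pythagoras phi e t :
  delaunay_cos phi e t ^+ 2 + delaunay_slope phi e t ^+ 2 +
  (sin e * sin t) ^+ 2 = 1.
Proof.
rewrite /delaunay_cos /delaunay_slope.
have h1 := cos2Dsin2 phi; have h2 := cos2Dsin2 e; have h3 := cos2Dsin2 t.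
transitivity ((cos phi ^+ 2 + sin phi ^+ 2) *
  (cos e ^+ 2 + (sin e * cos t) ^+ 2) + (sin e * sin t) ^+ 2); first by ring.
rewrite h1 mul1r -addrA !exprMn -mulrDr h3 mulr1; exact: h2.
Qed.

Lemma delaunay_slope_sq phi e t : delaunay_slope phi e t ^+ 2 =
  4 * (delaunay_sq phi e t * (1 - delaunay_sq phi e t)) - (sin e * sin t) ^+ 2.
Proof.
have := delaunay_pythagoras phi e t; rewrite /delaunay_sq.
move: (delaunay_cos _ _ _) (delaunay_slope _ _ _) (sin e * sin t) => x y z.
lra.
Qed.

Lemma delaunay_cos_half phi e t : delaunay_cos phi e t =
  cos (phi - e) - 2 * (sin phi * sin e * cos (t / 2) ^+ 2).
Proof.
rewrite /delaunay_cos cosB {1}(_ : t = (t / 2) *+ 2) ?cos_mulr2n; last first.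
  by rewrite -mulr_natr divfK.
by ring.
Qed.

(** This exhibits r^2 as a convex combination of its extreme values, the squared sines of (phi - e)
    / 2 and (phi + e) / 2. The second term alone gives positivity inside ]- pi, pi[, even at e =
    phi. *)
Lemma delaunay_sq_half phi e t : delaunay_sq phi e t =
  (1 - cos (phi - e)) / 2 * sin (t / 2) ^+ 2 +
  (1 - cos (phi + e)) / 2 * cos (t / 2) ^+ 2.
Proof.
by rewrite /delaunay_sq delaunay_cos_half sin2cos2 cosB cosD; field.
Qed.

Lemma cos_lt1 x : 0 < x < pi -> cos x < 1 :> R.
Proof.
move=> /andP[x0 xpi]; rewrite -cos0 ltr_cos // in_itv /= ?lexx ?pi_ge0 //.
by rewrite !ltW.
Qed.

Lemma cos_half_gt0 t : - pi < t < pi -> 0 < cos (t / 2).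
Proof.
by move=> /andP[t1 t2]; apply: cos_gt0_pihalf; rewrite -mulNr !ltr_pM2r ?t1.
Qed.

Lemma delaunay_sq_gt0 phi e t : 0 < phi + e < pi -> - pi < t < pi ->
  0 < delaunay_sq phi e t.
Proof.
move=> pe /cos_half_gt0 c0; rewrite delaunay_sq_half.
apply: ltr_wpDl; last first.
  by rewrite mulr_gt0 ?exprn_gt0 // divr_gt0 // subr_gt0 cos_lt1.
by rewrite mulr_ge0 ?sqr_ge0 // divr_ge0 // subr_ge0 cos_le1.
Qed.

Lemma delaunay_co_sq_gt phi e t : 0 < phi < pi / 2 -> - phi < e < pi / 2 ->
  (1 - sin phi) / 2 <= 1 - delaunay_sq phi e t.
Proof.
move=> /andP[phi0 phi1] /andP[e1 e2].
have cphi : 0 < cos phi.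
  by rewrite cos_gt0_pihalf // phi1 (lt_trans _ phi0) // oppr_lt0 pihalf_gt0.
have ce : 0 < cos e.
  by rewrite cos_gt0_pihalf // e2 andbT (lt_trans _ e1) // ltrN2.
have sphi : 0 < sin phi by apply: sin_gt0_pihalf; rewrite phi0.
have h : sin phi * (sin e * cos t) <= sin phi.
  by rewrite ger_pMr.
rewrite /delaunay_sq /delaunay_cos -mulrA.
have := mulr_gt0 cphi ce; lra.
Qed.

Lemma sin_lt1_pihalf phi : 0 < phi < pi / 2 -> sin phi < 1.
Proof.
move=> /andP[phi0 phi1]; have p0 := pihalf_gt0.
by rewrite -sin_pihalf ltr_sin // in_itv /=; apply/andP; split; lra.
Qed.

(** By [delaunay_slope_sq] the slope is at most 2 r rho in absolute value, which cancels the factor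
    r of the denominator; the remaining 1 / rho is controlled by [delaunay_co_sq_gt]. The bound
    depends neither on [e] nor on [t]. *)
Lemma delaunay_speed_bound phi e t : 0 < phi < pi / 2 -> - phi < e < pi / 2 ->
  `|delaunay_speed phi e t| <= sin phi / 2 / Num.sqrt ((1 - sin phi) / 2).
Proof.
move=> hphi he; have h := delaunay_co_sq_gt t hphi he.
have s1 := sin_lt1_pihalf hphi.
have sphi : 0 < sin phi by exact: sin_gt0_pihalf.
have m0 : 0 < (1 - sin phi) / 2 by rewrite divr_gt0 // subr_gt0.
have co0 := lt_le_trans m0 h.
rewrite /delaunay_speed; have := delaunay_slope_sq phi e t.
move: h co0; move: (delaunay_slope phi e t) (delaunay_sq phi e t) => L u.
move=> h co0 Lsq.
(* For [u] <= 0 the square root is 0, and so is its inverse by convention: the speed is 0. *)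
have [u0|u0] := leP u 0.
  rewrite ler0_sqrtr // mul0r invr0 mulr0 mulr0 normr0.
  by rewrite !mulr_ge0 // ?invr_ge0 ?sqrtr_ge0 // ltW.
have su : 0 < Num.sqrt u by rewrite sqrtr_gt0.
have sc : 0 < Num.sqrt (1 - u) by rewrite sqrtr_gt0.
have Lb : `|L| <= 2 * (Num.sqrt u * Num.sqrt (1 - u)).
  rewrite -ler_sqr ?nnegrE; [|exact: normr_ge0|by rewrite !mulr_ge0 // ltW].
  rewrite real_normK ?num_real // !exprMn (sqr_sqrtr (ltW u0)).
  rewrite (sqr_sqrtr (ltW co0)) Lsq.
  by have := sqr_ge0 (sin e * sin t); lra.
rewrite normrM gtr0_norm ?divr_gt0 // normrM.
rewrite (_ : sin phi / 2 / _ =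
  sin phi / 4 * (2 / Num.sqrt ((1 - sin phi) / 2))); last first.
  by field; rewrite gt_eqF ?sqrtr_gt0.
have den0 : 0 < Num.sqrt u * (1 - u) by rewrite mulr_gt0.
rewrite ler_pM2l ?divr_gt0 // normfV (gtr0_norm den0).
have uE : (Num.sqrt (1 - u)) * Num.sqrt (1 - u) = 1 - u.
  by rewrite -expr2 sqr_sqrtr // ltW.
apply: (@le_trans _ _ (2 / Num.sqrt (1 - u))).
  rewrite ler_pdivrMr //; apply: (le_trans Lb).
  have -> // : 2 / Num.sqrt (1 - u) * (Num.sqrt u * (1 - u)) =
    2 * (Num.sqrt u * Num.sqrt (1 - u)).
  by rewrite -[X in _ * (_ * X) = _]uE; field; rewrite gt_eqF.
by rewrite ler_pM2l // lef_pV2 ?posrE ?sqrtr_gt0 // ler_wsqrtr.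
Qed.

Lemma continuous_delaunay_cos_l phi t : continuous (fun e => delaunay_cos phi e t).
Proof.
move=> e; apply: cvgB; first by apply: cvgMl_tmp; exact: continuous_cos.
by apply: cvgMr_tmp; apply: cvgMl_tmp; exact: continuous_sin.
Qed.

Lemma continuous_delaunay_slope_l phi t :
  continuous (fun e => delaunay_slope phi e t).
Proof.
move=> e; apply: cvgD; first by apply: cvgMl_tmp; exact: continuous_cos.
by apply: cvgMr_tmp; apply: cvgMl_tmp; exact: continuous_sin.
Qed.

Lemma continuous_delaunay_cos phi e : continuous (delaunay_cos phi e).
Proof.
by move=> t; apply: cvgB; [exact: cvg_cst|apply: cvgMl_tmp; exact: continuous_cos].
Qed.

Lemma continuous_delaunay_slope phi e : continuous (delaunay_slope phi e).
Proof.
by move=> t; apply: cvgD; [exact: cvg_cst|apply: cvgMl_tmp; exact: continuous_cos].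
Qed.

(* [c] and [l] stand for [delaunay_cos] and [delaunay_slope]. *)
Lemma continuous_speed (T : topologicalType) (k : R) (c l : T -> R) x :
  {for x, continuous c} -> {for x, continuous l} ->
  0 < (1 - c x) / 2 -> 0 < 1 - (1 - c x) / 2 ->
  {for x, continuous (fun y => k * (l y /
    (Num.sqrt ((1 - c y) / 2) * (1 - (1 - c y) / 2))))}.
Proof.
move=> cc cl u0 w0.
have cu : {for x, continuous (fun y => (1 - c y) / 2)}.
  apply: continuousM; last exact: cst_continuous.
  by apply: continuousB => //; exact: cst_continuous.
apply: continuousM; first exact: cst_continuous.
apply: continuousM => //; apply: continuousV.
  by rewrite mulf_neq0 // gt_eqF // sqrtr_gt0.
apply: continuousM.
  apply: (@continuous_comp _ _ _ (fun y => (1 - c y) / 2)) => //.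
  exact: sqrt_continuous.
by apply: continuousB => //; exact: cst_continuous.
Qed.

Lemma continuous_delaunay_speed phi e t :
  0 < delaunay_sq phi e t -> 0 < 1 - delaunay_sq phi e t ->
  {for t, continuous (delaunay_speed phi e)} /\
  {for e, continuous (fun e' => delaunay_speed phi e' t)}.
Proof.
move=> u0 w0; split; apply: continuous_speed => //.
- exact: continuous_delaunay_cos.
- exact: continuous_delaunay_slope.
- exact: continuous_delaunay_cos_l.
- exact: continuous_delaunay_slope_l.
Qed.

Notation mu := (@lebesgue_measure R).

Definition delaunay_period phi e : R :=
  \int[mu]_(t in `]- pi, pi[) delaunay_speed phi e t.

Lemma delaunay_speed_integrable phi e : 0 < phi < pi / 2 -> - phi < e < pi / 2 ->
  mu.-integrable `]- pi, pi[%classic (EFin \o delaunay_speed phi e).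
Proof.
move=> hphi he; apply: measurable_bounded_integrable => //.
- rewrite /= lebesgue_measure_itv /= lte_fin; case: ifP => // _.
  by rewrite -EFinB ltry.
- apply: open_continuous_measurable_fun; first exact: interval_open.
  move=> t; rewrite inE /= in_itv /= => ht.
  apply: (continuous_delaunay_speed _ _).1.
    apply: delaunay_sq_gt0 => //; case/andP: hphi => p0 p1; case/andP: he => e0 e1.
    by rewrite -ltrBlDl sub0r e0 /= (splitr pi) ltrD.
  apply: lt_le_trans (delaunay_co_sq_gt t hphi he).
  by rewrite divr_gt0 // subr_gt0 sin_lt1_pihalf.
- exists (sin phi / 2 / Num.sqrt ((1 - sin phi) / 2)); split; first exact: num_real.
  by move=> B hB t _ /=; apply: le_trans (ltW hB); exact: delaunay_speed_bound.
Qed.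

(** Dominated convergence with a constant bound. The open interval contains both 0 and [phi], the
    ends at which the period is computed explicitly. *)
Lemma continuous_delaunay_period phi : 0 < phi < pi / 2 ->
  {in `]- phi, (pi / 2)[, continuous (delaunay_period phi)}.
Proof.
move=> hphi e he.
pose b := sin phi / 2 / Num.sqrt ((1 - sin phi) / 2).
apply: (@continuity_under_integral _ _ _ mu (delaunay_speed phi) _ _ (- phi) (pi / 2)
  _ _ (fun=> b)) => //.
- by move=> x; rewrite /= in_itv /=; exact: delaunay_speed_integrable.
- apply: aeW => t; rewrite /= in_itv /= => ht x; rewrite inE /= in_itv /= => hx.
  apply: (continuous_delaunay_speed _ _).2.
    apply: delaunay_sq_gt0 => //; case/andP: hphi => p0 p1; case/andP: hx => e0 e1.
    by rewrite -ltrBlDl sub0r e0 /= (splitr pi) ltrD.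
  apply: lt_le_trans (delaunay_co_sq_gt t hphi hx).
  by rewrite divr_gt0 // subr_gt0 sin_lt1_pihalf.
- apply: measurable_bounded_integrable => //.
    rewrite /= lebesgue_measure_itv /= lte_fin; case: ifP => // _.
    by rewrite -EFinB ltry.
  exact: bounded_cst.
- move=> x; rewrite /= in_itv /= => hx; apply: aeW => t _.
  exact: delaunay_speed_bound.
- by rewrite inE.
Qed.

End delaunay.

(** * The period in the limits of Clifford tori and of chains of spheres *)

Section delaunay_period_values.
Context {R : realType}.
Implicit Types phi e t : R.

Lemma sin_half_gt0 phi : 0 < phi < pi -> 0 < sin (phi / 2).
Proof.
move=> /andP[p0 p1]; apply: sin_gt0_pihalf.
by rewrite divr_gt0 //= ltr_pM2r.
Qed.

Lemma sin_double_half phi : sin phi = 2 * (sin (phi / 2) * cos (phi / 2)).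
Proof.
rewrite {1}(_ : phi = (phi / 2) *+ 2); last by rewrite -mulr_natr divfK.
by rewrite sin_mulr2n; ring.
Qed.

Lemma cos_double_half phi : cos phi = 1 - 2 * sin (phi / 2) ^+ 2.
Proof.
rewrite {1}(_ : phi = (phi / 2) *+ 2); last by rewrite -mulr_natr divfK.
by rewrite cos_mulr2n cos2sin2; ring.
Qed.

Lemma delaunay_period0 phi : 0 < phi < pi ->
  delaunay_period phi 0 = pi *+ 2 * sin (phi / 2).
Proof.
move=> hphi; have s0 := sin_half_gt0 hphi.
have c0 : 0 < cos (phi / 2).
  apply: cos_half_gt0; case/andP: hphi => p0 ->.
  by rewrite andbT (lt_trans _ p0) // oppr_lt0 pi_gt0.
rewrite /delaunay_period (eq_Rintegral _ (g := fun=> sin (phi / 2))); last first.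
  move=> t _; rewrite /delaunay_speed /delaunay_slope /delaunay_sq /delaunay_cos.
  rewrite sin0 cos0 !mulr0 !mul0r subr0 addr0 !mulr1.
  rewrite (_ : (1 - cos phi) / 2 = sin (phi / 2) ^+ 2); last first.
    by rewrite cos_double_half; field.
  rewrite sqrtr_sqr gtr0_norm // -cos2sin2 sin_double_half; field.
  by rewrite !gt_eqF.
rewrite Rintegral_cst //= lebesgue_measure_itv /= lte_fin gtrN ?pi_gt0 //=.
by ring.
Qed.

(** For e = [phi] one has r = sin phi cos (t / 2), and the speed has an elementary antiderivative,
    the arctangent of tan phi sin (t / 2): the profile is that of a round sphere seen under the
    angle 2 [phi]. *)
Lemma delaunay_period_diag phi : 0 < phi < pi / 2 ->
  delaunay_period phi phi = phi *+ 2.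
Proof.
move=> hphi; have sphi : 0 < sin phi by exact: sin_gt0_pihalf.
have p20 := @pihalf_gt0 R.
have cphi : 0 < cos phi.
  by apply: cos_gt0_pihalf; case/andP: hphi => p0 ->; rewrite andbT; lra.
pose den t := cos phi ^+ 2 + (sin phi * sin (t / 2)) ^+ 2.
have den0 t : 0 < den t by rewrite ltr_wpDr ?sqr_ge0 // exprn_gt0.
(* This agrees with the speed only on ]- pi, pi[, where cos (t / 2) is positive, but it is
   continuous everywhere. *)
pose g t := sin phi * cos phi * cos (t / 2) / 2 / den t.
pose G t := atan (tan phi * sin (t / 2)).
have cg : continuous g.
  have half t : (fun u : R => u / 2) x @[x --> t] --> t / 2.
    by apply: cvgMr_tmp; exact: cvg_id.
  have ch t : cos (u / 2) @[u --> t] --> cos (t / 2).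
    by apply: (@continuous_comp _ _ _ (fun u : R => u / 2)) => //;
      [exact: half|exact: continuous_cos].
  have sh t : sin (u / 2) @[u --> t] --> sin (t / 2).
    by apply: (@continuous_comp _ _ _ (fun u : R => u / 2)) => //;
      [exact: half|exact: continuous_sin].
  move=> t; apply: cvgM; first by apply: cvgMr_tmp; apply: cvgMl_tmp; exact: ch.
  apply: cvgV; first by rewrite gt_eqF.
  apply: cvgD; first exact: cvg_cst.
  have -> : (fun u => (sin phi * sin (u / 2)) ^+ 2) =
    (fun u => (sin phi * sin (u / 2)) * (sin phi * sin (u / 2))).
    by apply/funext => u; rewrite expr2.
  by apply: cvgM; apply: cvgMl_tmp; exact: sh.
have dG t : is_derive t (1 : R) G (g t).
  have h1 : is_derive t (1 : R) (fun u : R => 2^-1 * u) 2^-1.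
    apply: (is_derive_eq (is_deriveZ 2^-1 (is_derive_id t (1 : R)))).
    by rewrite /GRing.scale /= mulr1.
  have h2 : is_derive t (1 : R) (fun u => tan phi * sin (2^-1 * u))
      (tan phi * (cos (2^-1 * t) * 2^-1)).
    exact: (is_deriveZ (tan phi) (is_derive1_comp (is_derive_sin (2^-1 * t)) h1)).
  have h3 := @is_derive1_comp _ _ (fun u => tan phi * sin (2^-1 * u)) _ _ _
    (is_derive1_atan (tan phi * sin (2^-1 * t))) h2.
  have -> : G = atan \o (fun u => tan phi * sin (2^-1 * u)).
    by apply/funext => u; rewrite /G /= [u / 2]mulrC.
  apply: (is_derive_eq h3); rewrite /g [t / 2]mulrC /tan.
  have := den0 t; rewrite /den [t / 2]mulrC => d0.
  by field; rewrite !gt_eqF //= addrC.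
have ppi : - pi < pi :> R by rewrite gtrN ?pi_gt0.
transitivity (\int[lebesgue_measure]_(t in `](- pi), pi[) g t).
  apply: eq_Rintegral => t; rewrite inE /= in_itv /= => ht; have ct := cos_half_gt0 ht.
  rewrite /delaunay_speed /delaunay_slope.
  have uE : delaunay_sq phi phi t = (sin phi * cos (t / 2)) ^+ 2.
    by rewrite /delaunay_sq delaunay_cos_half subrr cos0; field.
  rewrite uE sqrtr_sqr gtr0_norm ?mulr_gt0 //.
  have dE : 1 - (sin phi * cos (t / 2)) ^+ 2 = den t.
    rewrite /den !exprMn [sin (t / 2) ^+ 2]sin2cos2 sin2cos2; ring.
  have := den0 t; rewrite dE /g => d0.
  rewrite [cos t]cos_double_half sin2cos2.
  by field; rewrite !gt_eqF.
rewrite (integral_derivative ppi cg dG) /G mulNr sinN sin_pihalf !mulrN !mulr1.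
rewrite atanN opprK tanK; first by rewrite mulr2n.
by rewrite in_itv /=; case/andP: hphi => p0 p1; apply/andP; split; lra.
Qed.

Lemma exists_delaunay_period phi T : 0 < phi < pi / 2 ->
  phi *+ 2 < T < pi *+ 2 * sin (phi / 2) ->
  exists2 e, 0 < e < phi & delaunay_period phi e = T.
Proof.
move=> hphi /andP[T1 T2]; have /andP[p0 p1] := hphi.
have p20 := @pihalf_gt0 R.
have P0 : delaunay_period phi 0 = pi *+ 2 * sin (phi / 2).
  by apply: delaunay_period0; rewrite p0; lra.
have P1 := delaunay_period_diag hphi.
have cP : {within `[0, phi], continuous (delaunay_period phi)}.
  apply: continuous_in_subspaceT => e; rewrite inE /= in_itv /= => /andP[e0 e1].
  by apply: continuous_delaunay_period => //; rewrite in_itv /=; apply/andP; split; lra.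
have [] := @IVT _ (delaunay_period phi) 0 phi T (ltW p0) cP.
  rewrite P0 P1 ge_min le_max; apply/andP; split; apply/orP; [right|left]; exact: ltW.
move=> e; rewrite in_itv /= => /andP[e0 e1] PT; exists e => //.
rewrite !lt_neqAle e0 e1 !andbT; apply/andP; split.
  by apply: contraTneq T2 => e00; rewrite -PT -e00 P0 ltxx.
by apply: contraTneq T1 => e00; rewrite -PT e00 P1 ltxx.
Qed.

End delaunay_period_values.

(** * The number of lobes *)

Section fold_number.
Context {R : realType}.
Implicit Types x b phi : R.

(** Concavity of the sine: the mean slope on [0, x] exceeds the one on [x, b], because the cosine
    decreases. *)
Lemma sin_chord x b : 0 < x < b -> b <= pi / 2 -> x * sin b < b * sin x.
Proof.
move=> /andP[x0 xb] bpi.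
have csin : continuous (@sin R) by exact: continuous_sin.
have [|c1 /[!in_itv]/= /andP[c10 c1x] e1] :=
  @MVT _ sin cos 0 x x0 (fun t _ => is_derive_sin t).
  exact: continuous_subspaceT.
have [|c2 /[!in_itv]/= /andP[c2x c2b] e2] :=
  @MVT _ sin cos x b xb (fun t _ => is_derive_sin t).
  exact: continuous_subspaceT.
rewrite sin0 !subr0 in e1.
have p0 := @pihalf_gt0 R.
have cc : cos c2 < cos c1.
  by rewrite ltr_cos ?in_itv /=; [lra|apply/andP; split; lra|apply/andP; split; lra].
rewrite -subr_gt0.
have -> : b * sin x - x * sin b = (b - x) * (x * (cos c1 - cos c2)).
  have -> : sin b = sin x + cos c2 * (b - x) by rewrite -e2; ring.
  by rewrite e1; ring.
by rewrite !mulr_gt0 // subr_gt0.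
Qed.

Lemma sin_pi6 : sin (pi / 6) = 1 / 2 :> R.
Proof.
have p0 := @pi_gt0 R.
have s0 : 0 < sin (pi / 6) :> R by apply: sin_gt0_pihalf; apply/andP; split; lra.
have : sin (pi / 2) = 1 :> R by exact: sin_pihalf.
rewrite (_ : pi / 2 = (pi / 6) *+ 2 + pi / 6); last by rewrite mulr2n; field.
rewrite sinD sin_mulr2n cos_mulr2n; have := cos2Dsin2 (pi / 6 : R).
move: (sin _) (cos _) s0 => s c s0 h1 h2.
have c2 : c ^+ 2 = 1 - s ^+ 2 by rewrite -h1; ring.
(* The triple-angle formula 3 s - 4 s^3 = 1, factored; positivity of [s] discards the root - 1. *)
have e : (s *+ 2 - 1) ^+ 2 * (s + 1) = 0.
  transitivity (1 - (s *+ 3 - s ^+ 3 *+ 4)); first by ring.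
  rewrite -[X in X - _]h2.
  transitivity (s * (c ^+ 2 *+ 4 - 1) - s * 3 + s ^+ 3 * 4); first by ring.
  by rewrite c2; ring.
move: e => /eqP; rewrite mulf_eq0 sqrf_eq0 => /orP[|] /eqP e; lra.
Qed.

Lemma tan_pi3 : tan (pi / 3) = Num.sqrt 3 :> R.
Proof.
have p0 := @pi_gt0 R.
have c0 : 0 < cos (pi / 6) :> R by apply: cos_gt0_pihalf; apply/andP; split; lra.
have c2 : cos (pi / 6) ^+ 2 = 3 / 4 :> R by rewrite cos2sin2 sin_pi6; field.
rewrite /tan (_ : pi / 3 = (pi / 6) *+ 2); last by rewrite mulr2n; field.
rewrite sin_mulr2n cos_mulr2n c2 sin_pi6.
have <- : Num.sqrt ((cos (pi / 6) * 2) ^+ 2) = Num.sqrt 3 :> R.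
  by congr Num.sqrt; rewrite exprMn c2; field.
rewrite sqrtr_sqr gtr0_norm; first by field.
by rewrite mulr_gt0.
Qed.

Lemma exists_fold phi : 0 < phi < pi / 2 -> phi != pi / 3 ->
  exists2 m : nat, (0 < m)%N &
    phi *+ 2 < pi *+ 2 / m%:R < pi *+ 2 * sin (phi / 2).
Proof.
move=> /andP[p0 p1]; have pi0 := @pi_gt0 R; rewrite neq_lt => /orP[plt|pgt].
  (* The number of lobes will be the largest m with m phi < pi; it is at least 3 since 3 phi <
     pi. *)
  have ex : exists n : nat, pi <= n%:R * phi.
    exists (Num.truncn (pi / phi)).+1; rewrite -ler_pdivrMr //.
    exact/ltW/truncnS_gt.
  case: (ex_minnP ex) => -[|m] hm min; first by lra.
  have mlt : m%:R * phi < pi.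
    by rewrite ltNge; apply/negP => /min; rewrite ltnn.
  have m2 : (2 < m)%N.
    rewrite ltnNge; apply/negP => m2.
    have : m.+1%:R <= 3%:R :> R by rewrite ler_nat.
    by move=> h; have := ler_wpM2r (ltW p0) h; lra.
  have m3 : 3%:R <= m%:R :> R by rewrite ler_nat.
  have m0 : 0 < m%:R :> R by lra.
  exists m; first by rewrite (leq_trans _ m2).
  (* The comparison point pi / 6 is chosen because phi / 2 < pi / 6 and its sine is 1 / 2. With (m +
     1) phi >= pi it gives sin (phi / 2) > 3 / (2 (m + 1)), which is at least 1 / m once m >= 2. *)
  have := @sin_chord (phi / 2) (pi / 6); rewrite sin_pi6 => ch.
  have {}ch : phi / 2 * (1 / 2) < pi / 6 * sin (phi / 2).
    by apply: ch; [apply/andP; split|]; lra.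
  move: ch; move: (sin _) => s ch.
  apply/andP; split; first by rewrite ltr_pdivlMr //; lra.
  rewrite ltr_pdivrMr //.
  rewrite -natr1 in hm.
  have h1 : 3 * pi < pi * (2 * (m%:R + 1) * s).
    have := @ler_wpM2r _ 3 (ler0n _ 3) _ _ hm.
    have m10 : 0 < m%:R + 1 :> R by lra.
    have : (m%:R + 1) * (phi / 2 * (1 / 2)) < (m%:R + 1) * (pi / 6 * s).
      by rewrite ltr_pM2l.
    lra.
  have h2 : 3 < 2 * (m%:R + 1) * s by rewrite -(ltr_pM2l pi0) [pi * 3]mulrC.
  have s0 : 0 < s by rewrite -(pmulr_rgt0 _ (_ : 0 < 2 * (m%:R + 1))); lra.
  have h3 : 0 <= (m%:R - 2) * s by rewrite mulr_ge0 ?ltW //; lra.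
  have h4 : 0 < m%:R * s - 1 by lra.
  by have := mulr_gt0 pi0 h4; lra.
(* Beyond pi / 3 two lobes suffice, since sin (phi / 2) > 1 / 2 and phi < pi / 2. *)
exists 2%N => //.
have -> : pi *+ 2 / 2%:R = pi :> R by field.
have s1 : sin (pi / 6) < sin (phi / 2).
  by rewrite ltr_sin ?in_itv /=; [lra|apply/andP; split; lra..].
rewrite sin_pi6 -subr_gt0 in s1.
by apply/andP; split; [lra|have := mulr_gt0 pi0 s1; lra].
Qed.

End fold_number.

(** * The meridian equations *)

(** Reversing the normal. The explicit construction produces the negative mean curvatures, and this
    supplies the positive ones. *)
Lemma rotational_profile_opp (R : realType) (H : R) :
  rotational_profile H -> inhabited (rotational_profile (- H)).
Proof.
move=> P; constructor.
apply: (@RotationalProfile R (- H) (prof_gens P) (prof_r P) (prof_rho P)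
  (fun x => - prof_a P x) (fun x => - prof_b P x) (fun x => - prof_k P x)
  (prof_dr P) (prof_drho P) (fun x => - prof_kappa P x)).
- exact: prof_gens_closed.
- exact: prof_gens_cos.
- exact: prof_gens_sin.
- exact: prof_gens_r.
- exact: prof_gens_rho.
- exact/generated_opp/prof_gens_a.
- exact/generated_opp/prof_gens_b.
- exact/generated_opp/prof_gens_k.
- by move=> x; have [-> -> -> -> ->] := prof_periodic P x.
- exact: prof_r_gt0.
- exact: prof_rho_gt0.
- exact: prof_derive_r.
- exact: prof_derive_rho.
- move=> x; apply: (is_derive_eq (is_deriveN (prof_derive_a P x))); ring.
- move=> x; apply: (is_derive_eq (is_deriveN (prof_derive_b P x))); ring.
- move=> x; apply: (is_derive_eq (is_deriveN (prof_derive_k P x))); ring.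
- exact: prof_sphere.
- by move=> x; rewrite -[RHS]oppr0 -(prof_normal_position P x); ring.
- by move=> x; rewrite -[RHS]oppr0 -(prof_normal_meridian P x); ring.
- by move=> x; rewrite !sqrrN prof_normal_unit.
- by move=> x; rewrite mulNr -opprD prof_mean mulNrn.
- have [x1 [x2 [x3 h]]] := prof_nonconstant P; exists x1, x2, x3.
  have e x : (- prof_kappa P x - - H) ^+ 2 = (prof_kappa P x - H) ^+ 2 by ring.
  by rewrite !e.
Qed.

(* The meridian equations in the coordinates r, rho, l = 2 a r, w = 2 k r rho,
   with the angle theta as independent variable. *)
Lemma rotational_profile_of_system (R : realType) (h : R) (r rho l w : R -> R) :
  (forall x, [/\ 0 < r x, 0 < rho x & 0 < l x]) ->
  (forall x, [/\ r (x + pi *+ 2) = r x, rho (x + pi *+ 2) = rho x,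
    l (x + pi *+ 2) = l x & w (x + pi *+ 2) = w x]) ->
  (forall x, r x ^+ 2 + rho x ^+ 2 = 1) ->
  (forall x, w x ^+ 2 + l x ^+ 2 = 4 * (r x ^+ 2 * rho x ^+ 2)) ->
  (forall x, is_derive x (1 : R) r (- (w x * rho x ^+ 2 / l x))) ->
  (forall x, is_derive x (1 : R) rho (w x * r x * rho x / l x)) ->
  (forall x, is_derive x (1 : R) l (- (4 * h * w x * r x * rho x ^+ 2 / l x))) ->
  (forall x, is_derive x (1 : R) w
    (4 * (h * l x - (rho x ^+ 2 - r x ^+ 2)) * r x * rho x ^+ 2 / l x)) ->
  (exists x1 x2 x3, let q x := (l x / (2 * r x ^+ 2) - h) ^+ 2 in
    [/\ q x1 != q x2, q x1 != q x3 & q x2 != q x3]) ->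
  inhabited (rotational_profile (- h)).
Proof.
move=> pos per sph wl dr drho dl dw nonc.
have rn x : r x != 0 by have [h1 _ _] := pos x; rewrite gt_eqF.
have pn x : rho x != 0 by have [_ h1 _] := pos x; rewrite gt_eqF.
have ln x : l x != 0 by have [_ _ h1] := pos x; rewrite gt_eqF.
have dri x := is_deriveV (rn x) (dr x).
have drhoi x := is_deriveV (pn x) (drho x).
have dli x := is_deriveV (ln x) (dl x).
pose ri x := (r x)^-1; pose rhoi x := (rho x)^-1; pose li x := (l x)^-1.
(* The inverses are included as generators because the system divides by [l] and the normal by [r]
   and [rho]. *)
pose G : set (R -> R) := [set f | [\/ f = cos, f = sin, f = r | f = ri] \/
  ([\/ f = rho, f = rhoi, f = l | f = li] \/ f = w)].
have Gcos : G cos by left; constructor 1.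
have Gsin : G sin by left; constructor 2.
have Gr : generated_ring G r by apply: generated_in; left; constructor 3.
have Gri : generated_ring G ri by apply: generated_in; left; constructor 4.
have Grho : generated_ring G rho by apply: generated_in; right; left; constructor 1.
have Grhoi : generated_ring G rhoi by apply: generated_in; right; left; constructor 2.
have Gl : generated_ring G l by apply: generated_in; right; left; constructor 3.
have Gli : generated_ring G li by apply: generated_in; right; left; constructor 4.
have Gw : generated_ring G w by apply: generated_in; right; right.
have genC c := @generated_cst R R G c.
have Gdr : generated_ring G (fun x => - (w x * (rho x * rho x) * li x)).
  by apply: generated_opp; do 2 (apply: generated_mul => //); exact: generated_mul.
have Gdrho : generated_ring G (fun x => w x * r x * rho x * li x).
  by do 3 (apply: generated_mul => //).
have Gdl : generated_ring G (fun x => - (4 * h * w x * r x * (rho x * rho x) * li x)).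
  apply: generated_opp; apply: generated_mul => //.
  apply: generated_mul; last exact: generated_mul.
  by apply: generated_mul => //; apply: generated_mul.
have Gdw : generated_ring G (fun x =>
    4 * (h * l x + - (rho x * rho x + - (r x * r x))) * r x *
      (rho x * rho x) * li x).
  apply: generated_mul => //; apply: generated_mul; last exact: generated_mul.
  do 2 (apply: generated_mul => //); apply: generated_add.
    exact: generated_mul.
  apply: generated_opp; apply: generated_add; first exact: generated_mul.
  by apply: generated_opp; exact: generated_mul.
have Gclosed : derivative_closed G.
  move=> f [[]|[[]|]] ->.
  - exists (fun x => - sin x); last by move=> x; exact: is_derive_cos.
    by apply: generated_opp; exact: generated_in.
  - exists cos; last by move=> x; exact: is_derive_sin.
    exact: generated_in.
  - exists (fun x => - (w x * (rho x * rho x) * li x)) => //; exact: dr.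
  - exists (fun x => - (ri x * ri x) * - (w x * (rho x * rho x) * li x)).
      by apply: generated_mul => //; apply: generated_opp; exact: generated_mul.
    move=> x; apply: (is_derive_eq (dri x)); rewrite /ri /li /GRing.scale /=.
    by field; rewrite rn ln.
  - exists (fun x => w x * r x * rho x * li x) => //; exact: drho.
  - exists (fun x => - (rhoi x * rhoi x) * (w x * r x * rho x * li x)).
      by apply: generated_mul => //; apply: generated_opp; exact: generated_mul.
    move=> x; apply: (is_derive_eq (drhoi x)); rewrite /rhoi /li /GRing.scale /=.
    by field; rewrite pn ln.
  - exists (fun x => - (4 * h * w x * r x * (rho x * rho x) * li x)) => //; exact: dl.
  - exists (fun x => - (li x * li x) * - (4 * h * w x * r x * (rho x * rho x) * li x)).
      by apply: generated_mul => //; apply: generated_opp; exact: generated_mul.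
    move=> x; apply: (is_derive_eq (dli x)); rewrite /li /GRing.scale /=.
    by field; rewrite ln.
  - exists (fun x =>
      4 * (h * l x + - (rho x * rho x + - (r x * r x))) * r x *
        (rho x * rho x) * li x) => //; exact: dw.
constructor; apply: (@RotationalProfile R (- h) G r rho
  (fun x => 2^-1 * (l x * ri x)) (fun x => - (2^-1 * (l x * rhoi x)))
  (fun x => 2^-1 * (w x * ri x * rhoi x))
  (fun x => - (w x * rho x ^+ 2 / l x)) (fun x => w x * r x * rho x / l x)
  (fun x => l x / (2 * r x ^+ 2) - h *+ 2)) => //.
- by apply: generated_mul => //; apply: generated_mul.
- by apply: generated_opp; apply: generated_mul => //; apply: generated_mul.
- by apply: generated_mul => //; apply: generated_mul => //; apply: generated_mul.
- by move=> x; rewrite /ri /rhoi; have [-> -> -> ->] := per x.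
- by move=> x; case: (pos x).
- by move=> x; case: (pos x).
- move=> x; apply: (is_derive_eq (is_deriveZ 2^-1 (is_deriveM (dl x) (dri x)))).
  rewrite /ri /GRing.scale /=; field; rewrite rn ln //.
- move=> x; apply: (is_derive_eq
    (is_deriveN (is_deriveZ 2^-1 (is_deriveM (dl x) (drhoi x))))).
  rewrite /ri /rhoi /GRing.scale ?fctE /=; apply/eqP; rewrite -subr_eq0; apply/eqP.
  transitivity ((r x ^+ 2 + rho x ^+ 2 - 1) * (w x / (2 * r x * rho x))).
    by field; rewrite rn pn ln.
  by rewrite sph subrr mul0r.
- move=> x; apply: (is_derive_eq
    (is_deriveZ 2^-1 (is_deriveM (is_deriveM (dw x) (dri x)) (drhoi x)))).
  rewrite /ri /rhoi /GRing.scale ?fctE /=; apply/eqP; rewrite -subr_eq0; apply/eqP.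
  transitivity ((w x ^+ 2 + l x ^+ 2 - 4 * (r x ^+ 2 * rho x ^+ 2)) *
      ((rho x ^+ 2 - r x ^+ 2) / (2 * l x * r x ^+ 2 * rho x))).
    by field; rewrite rn pn ln.
  by rewrite wl subrr mul0r.
- by move=> x; rewrite /ri /rhoi; field; rewrite rn pn.
- move=> x; rewrite /ri /rhoi.
  transitivity ((1 - (r x ^+ 2 + rho x ^+ 2)) * (w x / (2 * r x))).
    by field; rewrite rn pn ln.
  by rewrite sph subrr mul0r.
- move=> x; rewrite /ri /rhoi.
  transitivity ((w x ^+ 2 + l x ^+ 2 * (r x ^+ 2 + rho x ^+ 2)) /
      (4 * (r x ^+ 2 * rho x ^+ 2))).
    by field; rewrite rn pn.
  rewrite sph mulr1 wl divff // !mulf_neq0 // ?expf_neq0 //.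
- by move=> x; rewrite /ri; field; rewrite rn.
- have [x1 [x2 [x3 /= q]]] := nonc; exists x1, x2, x3.
  have e x : l x / (2 * r x ^+ 2) - h *+ 2 - - h = l x / (2 * r x ^+ 2) - h by ring.
  by rewrite !e.
Qed.

(** * Closed Delaunay profiles parametrized by theta *)

Section delaunay_profile.
Context {R : realType} (phi e : R).
Context (hphi : 0 < phi < pi / 2) (he : 0 < e < phi).
Local Notation u := (delaunay_sq phi e).
Local Notation l := (delaunay_slope phi e).
Local Notation g := (delaunay_speed phi e).

Lemma sin_phi_gt0 : 0 < sin phi. Proof. exact: sin_gt0_pihalf. Qed.

Lemma sin_e_gt0 : 0 < sin e.
Proof.
move: hphi he => /andP[p0 p1] /andP[e0 e1].
by apply: sin_gt0_pihalf; apply/andP; split; lra.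
Qed.

(** With e < phi strictly, both extreme values of r^2 are positive, so the end points t = pi and t =
    - pi need no exclusion. *)
Lemma delaunay_sq_pos t : 0 < u t.
Proof.
move: hphi he => /andP[p0 p1] /andP[e0 e1].
have cl x : 0 < x < pi -> 0 < 1 - cos x :> R by move=> /cos_lt1; rewrite subr_gt0.
have a0 : 0 < 1 - cos (phi - e) by apply: cl; apply/andP; split; lra.
have b0 : 0 < 1 - cos (phi + e) by apply: cl; apply/andP; split; lra.
rewrite delaunay_sq_half cos2sin2.
have := sqr_ge0 (sin (t / 2)); have := sqr_ge0 (cos (t / 2)); rewrite cos2sin2.
move: (sin (t / 2) ^+ 2) => s h1 h2.
have hb : 0 <= (1 - cos (phi + e)) * (1 - s) by rewrite mulr_ge0 // ltW.
have ha : 0 <= (1 - cos (phi - e)) * s by rewrite mulr_ge0 // ltW.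
have [s0|s0] := leP s (1 / 2).
  have hb' : 0 < (1 - cos (phi + e)) * (1 - s) by rewrite mulr_gt0 //; lra.
  lra.
have ha' : 0 < (1 - cos (phi - e)) * s by rewrite mulr_gt0 //; lra.
lra.
Qed.

Lemma delaunay_co_sq_pos t : 0 < 1 - u t.
Proof.
move: hphi he => /andP[p0 p1] /andP[e0 e1].
apply: lt_le_trans (delaunay_co_sq_gt t hphi _).
  by rewrite divr_gt0 // subr_gt0 sin_lt1_pihalf.
by apply/andP; split; lra.
Qed.

(** The minimum, at cos t = -1, is sin (phi - e) > 0. Hence theta increases with t and the profile
    is a graph over theta. *)
Lemma delaunay_slope_pos t : 0 < l t.
Proof.
move: hphi he => /andP[p0 p1] /andP[e0 e1].
have se := sin_e_gt0.
have cp : 0 < cos phi by apply: cos_gt0_pihalf; apply/andP; split; lra.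
have : 0 < sin (phi - e) by apply: sin_gt0_pihalf; apply/andP; split; lra.
rewrite sinB /delaunay_slope => h.
have : 0 <= cos phi * sin e * (1 + cos t).
  by rewrite !mulr_ge0 //; have := cos_geN1 t; lra.
lra.
Qed.

Lemma continuous_speed_full : continuous g.
Proof.
by move=> t; apply: (continuous_delaunay_speed _ _).1;
  [exact: delaunay_sq_pos|exact: delaunay_co_sq_pos].
Qed.

Lemma delaunay_speed_gt0 t : 0 < g t.
Proof.
rewrite /delaunay_speed mulr_gt0 ?divr_gt0 ?sin_phi_gt0 ?delaunay_slope_pos //.
by rewrite mulr_gt0 ?sqrtr_gt0 ?delaunay_sq_pos ?delaunay_co_sq_pos.
Qed.

Lemma delaunay_speed_periodic t : g (t + pi *+ 2) = g t.
Proof.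
by rewrite /delaunay_speed /delaunay_sq /delaunay_cos /delaunay_slope cosD2pi.
Qed.

(** This is the flux law: the slope minus 2 cot phi r^2 is constant. Its left side is the deviation
    of the meridian curvature from the mean curvature, so that deviation is inversely proportional
    to r^2. *)
Lemma delaunay_slope_lin t :
  l t / (2 * u t) - cos phi / sin phi =
  (cos e - cos phi) / (2 * sin phi) / u t.
Proof.
have s0 := sin_phi_gt0; have u0 := delaunay_sq_pos t.
have h : l t * sin phi = 2 * cos phi * u t + cos e - cos phi.
  rewrite /delaunay_slope /delaunay_sq /delaunay_cos.
  transitivity ((sin phi ^+ 2) * cos e + cos phi * (sin phi * sin e * cos t)).
    by ring.
  by rewrite sin2cos2; field.
have -> : l t = (2 * cos phi * u t + cos e - cos phi) / sin phi.
  by rewrite -h mulfK // gt_eqF.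
by field; rewrite !gt_eqF.
Qed.

Lemma delaunay_profile (m : nat) : (0 < m)%N ->
  delaunay_period phi e = pi *+ 2 / m%:R ->
  inhabited (rotational_profile (- (cos phi / sin phi))).
Proof.
move=> m0 per; have s0 := sin_phi_gt0; have cg := continuous_speed_full.
have pi0 := @pi_gt0 R.
have [G dG] := exists_antiderivative cg.
have GpiE t : G (t + pi *+ 2) = G t + pi *+ 2 / m%:R.
  apply/eqP; rewrite -subr_eq0 opprD addrA subr_eq0; apply/eqP.
  rewrite (antiderivative_periodic dG delaunay_speed_periodic t (- pi)).
  rewrite (_ : - pi + pi *+ 2 = pi); last by ring.
  by rewrite -per /delaunay_period (integral_derivative _ cg dG) // gtrN.
have pp0 : 0 < pi *+ 2 :> R by rewrite pmulrn_lgt0.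
have q0 : 0 < pi *+ 2 / m%:R :> R by rewrite divr_gt0 // ltr0n.
have [S [GK SK dS]] := exists_inverse dG delaunay_speed_gt0 pp0 q0 GpiE.
(* One turn in theta runs through m periods of t; this makes the profile close up after a single
   turn. *)
have SpiE y : S (y + pi *+ 2) = S y + (pi *+ 2) *+ m.
  apply: (can_inj GK); rewrite SK.
  have GnE n t : G (t + (pi *+ 2) *+ n) = G t + pi *+ 2 / m%:R *+ n.
    elim: n => [|n IH]; first by rewrite !mulr0n !addr0.
    by rewrite ![_ *+ n.+1]mulrSr addrA GpiE IH addrA.
  by rewrite GnE SK -[_ *+ m]mulr_natr divfK // pnatr_eq0 -lt0n.
pose r y := Num.sqrt (u (S y)); pose rho y := Num.sqrt (1 - u (S y)).
have r0 y : 0 < r y by rewrite sqrtr_gt0 delaunay_sq_pos.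
have rho0 y : 0 < rho y by rewrite sqrtr_gt0 delaunay_co_sq_pos.
have l0 y : 0 < l (S y) by exact: delaunay_slope_pos.
have rE y : r y ^+ 2 = u (S y) by rewrite sqr_sqrtr // ltW // delaunay_sq_pos.
have rhoE y : rho y ^+ 2 = 1 - u (S y).
  by rewrite sqr_sqrtr // ltW // delaunay_co_sq_pos.
have speedE y : (g (S y))^-1 = 4 * r y * rho y ^+ 2 / (sin phi * l (S y)).
  rewrite /delaunay_speed -/(r y) -rhoE; field.
  by rewrite !gt_eqF.
have dcos y : is_derive y (1 : R) (fun z => cos (S z)) (- sin (S y) * (g (S y))^-1).
  exact: (is_derive1_comp (is_derive_cos (S y)) (dS y)).
have dsin y : is_derive y (1 : R) (fun z => sin (S z)) (cos (S y) * (g (S y))^-1).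
  exact: (is_derive1_comp (is_derive_sin (S y)) (dS y)).
have du y : is_derive y (1 : R) (fun z => u (S z))
    (- (sin phi * sin e * sin (S y) * (g (S y))^-1 / 2)).
  have -> : (fun z => u (S z)) = (fun z =>
      (1 - cos phi * cos e) / 2 + sin phi * sin e / 2 * cos (S z)).
    by apply/funext => z; rewrite /delaunay_sq /delaunay_cos; field.
  apply: (is_derive_eq (is_deriveD (is_derive_cst _ y (1 : R))
    (is_deriveZ (sin phi * sin e / 2) (dcos y)))).
  by rewrite /GRing.scale /=; ring.
have dl y : is_derive y (1 : R) (fun z => l (S z))
    (- (cos phi * sin e * sin (S y) * (g (S y))^-1)).
  apply: (is_derive_eq (is_deriveD (is_derive_cst _ y (1 : R))
    (is_deriveZ (cos phi * sin e) (dcos y)))).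
  by rewrite /GRing.scale /=; ring.
apply: (@rotational_profile_of_system R (cos phi / sin phi) r rho
  (fun y => l (S y)) (fun y => sin e * sin (S y))).
- by move=> y; split.
- move=> y; rewrite /r /rho SpiE /delaunay_slope /delaunay_sq /delaunay_cos.
  by rewrite (periodicn (@cosD2pi R)) (periodicn (@sinD2pi R)).
- by move=> y; rewrite rE rhoE; ring.
- by move=> y; rewrite rE rhoE delaunay_slope_sq; ring.
- move=> y; apply: (is_derive_eq
    (@is_derive1_comp _ Num.sqrt (fun z => u (S z)) y _ _
      (is_derive1_sqrt (delaunay_sq_pos (S y))) (du y))).
  by rewrite -/(r y) speedE; field; rewrite !gt_eqF.
- move=> y; have dv : is_derive y (1 : R) (fun z => 1 - u (S z))
      (sin phi * sin e * sin (S y) * (g (S y))^-1 / 2).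
    apply: (is_derive_eq (is_deriveB (is_derive_cst (1 : R) y (1 : R)) (du y))).
    by rewrite sub0r opprK.
  apply: (is_derive_eq (@is_derive1_comp _ Num.sqrt (fun z => 1 - u (S z)) y _ _
    (is_derive1_sqrt (delaunay_co_sq_pos (S y))) dv)).
  by rewrite -/(rho y) speedE; field; rewrite !gt_eqF.
- move=> y; apply: (is_derive_eq (dl y)).
  by rewrite speedE; field; rewrite !gt_eqF.
- move=> y; apply: (is_derive_eq (is_deriveZ (sin e) (dsin y))).
  rewrite /GRing.scale /= speedE.
  (* The inverse of the rotation by phi that sends (cos e, sin e cos t) to (cos c, slope), where cos
     c = rho^2 - r^2. *)
  have h : sin e * cos (S y) =
      cos phi * l (S y) - sin phi * (rho y ^+ 2 - r y ^+ 2).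
    rewrite rE rhoE /delaunay_slope /delaunay_sq /delaunay_cos.
    rewrite -[LHS]mul1r -[X in X * _ = _](cos2Dsin2 phi).
    by field.
  rewrite mulrA h; field; rewrite !gt_eqF //.
(* At t = 0, pi / 2, pi the cosine, hence r^2, takes three distinct values; the deviation is
   positive and strictly decreasing in r^2, so its squares are distinct as well. *)
- exists (G 0), (G (pi / 2)), (G pi).
  cbv zeta beta; rewrite !rE !GK !delaunay_slope_lin.
  set c := (cos e - cos phi) / (2 * sin phi).
  have c0 : 0 < c.
    move: hphi he => /andP[p0 p1] /andP[e0 e1].
    rewrite divr_gt0 ?mulr_gt0 // subr_gt0 ltr_cos // in_itv /=; apply/andP; split; lra.
  have q t s : u s < u t -> (c / u t) ^+ 2 < (c / u s) ^+ 2.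
    have ut := delaunay_sq_pos t; have us := delaunay_sq_pos s => h.
    have h1 : c / u t < c / u s by rewrite ltr_pM2l // ltf_pV2.
    have h2 : 0 < c / u t by exact: divr_gt0.
    by rewrite ltr_pXn2r ?nnegrE //; apply: ltW => //; exact: lt_trans h1.
  have se := sin_e_gt0; have sse := mulr_gt0 s0 se.
  have uc t s : cos s < cos t -> u s < u t.
    rewrite /delaunay_sq /delaunay_cos => h.
    have : sin phi * sin e * cos s < sin phi * sin e * cos t by rewrite ltr_pM2l.
    lra.
  split; rewrite lt_eqF //; apply: q; apply: uc; rewrite ?cos0 ?cospi ?cos_pihalf; lra.
Qed.

End delaunay_profile.

Lemma exists_rotational_profile (R : realType) (h : R) : 0 < h ->
  h <> 1 / Num.sqrt 3 -> inhabited (rotational_profile (- h)).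
Proof.
(* This choice makes h = cot phi, and the excluded value of h corresponds to phi = pi / 3. *)
move=> h0 hn; pose phi := atan h^-1.
have p0 : 0 < phi by rewrite -atan0 lt_atan // invr_gt0.
have hphi : 0 < phi < pi / 2 by rewrite p0 atan_ltpi2.
have tanphi : tan phi = h^-1 by exact: atanK.
have hE : h = cos phi / sin phi.
  by rewrite -[LHS]invrK -tanphi /tan invf_div.
have pn : phi != pi / 3.
  apply/eqP => e; apply: hn; move: tanphi; rewrite e tan_pi3 => ->.
  by rewrite div1r invrK.
have [m m0 hm] := exists_fold hphi pn.
have [e he per] := exists_delaunay_period hphi hm.
by rewrite hE; exact: (delaunay_profile hphi he m0 per).
Qed.

Theorem theorem4p2 (R : realType) (H : R)
    (H_neq0 : H <> 0)
    (H_neq_pos : H <> 1 / Num.sqrt 3)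
    (H_neq_neg : H <> - (1 / Num.sqrt 3)) :
  exists M : set 'rV[R]_4,
    [/\ embedded_compact_surface M,
        has_constant_mean_curvature M H
      & ~ isoparametric M].
Proof.
have [P] : inhabited (rotational_profile H).
  have [Hneg|Hpos|//] := ltgtP H 0.
    rewrite -[H]opprK; apply: exists_rotational_profile.
      by rewrite oppr_gt0.
    by move=> e; apply: H_neq_neg; rewrite -e opprK.
  have [P] := exists_rotational_profile Hpos H_neq_pos.
  by rewrite -[H]opprK; exact: rotational_profile_opp P.
exists (rot_surface P); split.
- exact: rot_surface_embedded.
- exact: rot_surface_cmc.
- exact: rot_surface_not_isoparametric.
Qed.
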